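(* Let $(M,g)$ be a Riemannian manifold, let $(N,J,h)$ be a Hermitian manifold, and let $\varphi:(M,g)\to (N,J,h)$ be a (smooth) submersion. Then $\varphi$ is a pseudo-harmonic morphism if and only if $\varphi$ is pseudo horizontally weakly conformal (PHWC) and its induced $f$-structure $F$ is cosymplectic, i.e. $F\,\mathrm{div}\,F=0$.
   Context: A Hermitian manifold $(N,J,h)$ is a complex manifold (integrable $J$) with a $J$-compatible Riemannian metric $h$; a (locally defined) function $f:N\to\mathbb{C}$ is holomorphic if $df\circ J=\mathrm{i}\,df$. A map $\varphi:(M,g)\to (N,J)$ from a Riemannian manifold to a complex manifold is a pseudo-harmonic morphism (PHM) if for every holomorphic function $f$ defined on an open subset of $N$ the complex-valued function $f\circ\varphi$ is harmonic on its domain in $(M,g)$. (No metric on $N$ is involved and $\varphi$ is not assumed harmonic.) A map $\varphi:(M,g)\to(N,J,h)$ is PHWC if $[d\varphi\circ d\varphi^{*},J]=0$ at every point, where $d\varphi_x^*:T_{\varphi(x)}N\to T_xM$ is the adjoint: $g(X,d\varphi_x^*(E))=h(d\varphi_x(X),E)$. For a PHWC submersion let $\mathcal{V}=\ker d\varphi$ and $\mathcal{H}=\mathcal{V}^{\perp}$. The induced $f$-structure $F$ is the endomorphism field of $TM$ with $F|_{\mathcal{V}}=0$ and $F|_{\mathcal{H}}=(d\varphi|_{\mathcal{H}})^{-1}\circ J\circ d\varphi|_{\mathcal{H}}$; it satisfies $F^3+F=0$, and PHWC is equivalent to $F|_{\mathcal H}$ being compatible with $g$. With $\nabla$ the Levi-Civita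 connection of $g$, $\mathrm{div}\,F=\mathrm{trace}_g\nabla F=\sum_a(\nabla_{e_a}F)(e_a)$ for a local orthonormal frame $\{e_a\}$ of $TM$. *)

(* Defs.v *)
From HB Require Import structures.
From mathcomp Require Import all_boot all_order all_algebra complex.
From mathcomp Require Import all_classical all_reals all_analysis ring.

Set Implicit Arguments.
Unset Strict Implicit.
Unset Printing Implicit Defensive.

Import Order.TTheory GRing.Theory Num.Theory numFieldNormedType.Exports.

Local Open Scope classical_set_scope.
Local Open Scope ring_scope.

(* Conventions.  Vectors are rows, and linear maps act on the right: the       *)
(* differential of phi sends X to X *m D with D its library [jacobian], and    *)
(* the matrix A of an endomorphism sends the coordinate field d_j to           *)
(* \sum_k A j k d_k.  Tensor fields are given by their components in all the   *)
(* charts of the (maximal) atlas, subject to the tensorial transformation law; *)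
(* components in a chart are only meaningful at points of its domain.          *)

Section Smooth.
Context {R : realType} {m : nat}.
Implicit Types (U : set 'rV[R]_m) (f : 'rV[R]_m -> R).

Definition partial (i : 'I_m) f (u : 'rV[R]_m) : R := 'D_(delta_mx 0 i) f u.

(* Only used on open sets U. *)
Fixpoint is_Ck (k : nat) U f : Prop :=
  match k with
  | 0%N => forall u, U u -> {for u, continuous f}
  | k'.+1 => (forall u, U u -> differentiable f u) /\
             (forall i, is_Ck k' U (partial i f))
  end.

Definition is_smooth U f := forall k, is_Ck k U f.

End Smooth.

(* A homeomorphism between an open subset of M and an open subset of R^m; the  *)
(* values of both functions outside these open sets are irrelevant.            *)
Record chart (R : realType) (M : topologicalType) (m : nat) := Chart {
  chart_map :> M -> 'rV[R]_m;
  chart_inv : 'rV[R]_m -> M;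
  chart_dom : set M;
  chart_dom_open : open chart_dom;
  chart_codom_open : open (chart_map @` chart_dom);
  chart_mapK : forall x, chart_dom x -> chart_inv (chart_map x) = x;
  chart_map_continuous :
    forall x, chart_dom x -> {for x, continuous chart_map};
  chart_inv_continuous : forall u, (chart_map @` chart_dom) u ->
    {for u, continuous chart_inv}
}.

Definition smooth_transition (R : realType) (M : topologicalType) (m : nat)
    (c d : chart R M m) :=
  forall j, is_smooth (c @` (chart_dom c `&` chart_dom d))
              (fun u => d (chart_inv c u) 0 j).

Definition compatible (R : realType) (M : topologicalType) (m : nat)
    (c d : chart R M m) :=
  smooth_transition c d /\ smooth_transition d c.

Record smooth_manifold (R : realType) (m : nat) := SmoothManifold {
  carrier :> topologicalType;
  carrier_hausdorff : hausdorff_space carrier;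
  carrier_second_countable : @second_countable carrier;
  atlas : set (chart R carrier m);
  atlas_cover : forall x, exists2 c, atlas c & chart_dom c x;
  atlas_compatible :
    forall c d, atlas c -> atlas d -> compatible c d;
  atlas_maximal :
    forall c, (forall d, atlas d -> compatible c d) -> atlas c
}.

(* c is a chart of the manifold around x *)
Definition chart_at (R : realType) (m : nat) (M : smooth_manifold R m)
    (c : chart R M m) (x : M) := atlas c /\ chart_dom c x.

Section LocalExpressions.
Context {R : realType} {m : nat} {M : smooth_manifold R m}.
Implicit Types (c d : chart R M m) (f : M -> R) (x : M) (U : set M).

Definition smooth_on U f := forall c, atlas c ->
  is_smooth (c @` (chart_dom c `&` U)) (f \o chart_inv c).

Definition C2_on U f := forall c, atlas c ->
  is_Ck 2 (c @` (chart_dom c `&` U)) (f \o chart_inv c).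

(* the coordinate derivative d_i f at x *)
Definition cderiv c (i : 'I_m) f x : R := partial i (f \o chart_inv c) (c x).

(* matrix at x of the change of coordinates from c to d *)
Definition transition_mx c d x : 'M[R]_m := jacobian (d \o chart_inv c) (c x).

End LocalExpressions.

Section Differential.
Context {R : realType} {m n : nat}.
Context {M : smooth_manifold R m} {N : smooth_manifold R n}.
Implicit Types (phi : M -> N) (c : chart R M m) (d : chart R N n).

Definition differential_mx phi c d (x : M) : 'M[R]_(m, n) :=
  jacobian (d \o phi \o chart_inv c) (c x).

Definition smooth_map phi := continuous phi /\
  forall c d, atlas c -> atlas d -> forall j,
    is_smooth (c @` (chart_dom c `&` phi @^-1` chart_dom d))
      (fun u => d (phi (chart_inv c u)) 0 j).

Definition submersion phi := smooth_map phi /\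
  forall c d x, chart_at c x -> chart_at d (phi x) ->
    row_full (differential_mx phi c d x).

End Differential.

Record riemannian_metric (R : realType) (m : nat) (M : smooth_manifold R m) :=
  RiemannianMetric {
  metric_mx :> chart R M m -> M -> 'M[R]_m;
  metric_sym : forall c x, chart_at c x -> (metric_mx c x)^T = metric_mx c x;
  metric_pos : forall c x, chart_at c x -> forall X : 'rV[R]_m, X != 0 ->
    0 < (X *m metric_mx c x *m X^T) 0 0;
  metric_smooth : forall c, atlas c -> forall i j,
    is_smooth (c @` chart_dom c) (fun u => metric_mx c (chart_inv c u) i j);
  metric_transition : forall c d x, chart_at c x -> chart_at d x ->
    metric_mx c x =
      transition_mx c d x *m metric_mx d x *m (transition_mx c d x)^T
}.

(* a field of endomorphisms of the tangent bundle, i.e. a (1,1)-tensor field *)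
Record endo_field (R : realType) (m : nat) (M : smooth_manifold R m) :=
  EndoField {
  endo_mx :> chart R M m -> M -> 'M[R]_m;
  endo_smooth : forall c, atlas c -> forall i j,
    is_smooth (c @` chart_dom c) (fun u => endo_mx c (chart_inv c u) i j);
  endo_transition : forall c d x, chart_at c x -> chart_at d x ->
    endo_mx c x *m transition_mx c d x = transition_mx c d x *m endo_mx d x
}.

Section RiemannianGeometry.
Context {R : realType} {m : nat} {M : smooth_manifold R m}.
Variable g : riemannian_metric M.
Implicit Types (c : chart R M m) (x : M) (F : endo_field M).

Definition pairing c x (X Y : 'rV[R]_m) : R := (X *m g c x *m Y^T) 0 0.

(* g^{ij} *)
Definition cometric c x : 'M[R]_m := invmx (g c x).

(* Gamma_{ij}^k, the components of the Levi-Civita connection:                 *)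
(* nabla_{d_i} d_j = \sum_k Gamma_{ij}^k d_k                                   *)
Definition christoffel c x (i j k : 'I_m) : R :=
  2^-1 * \sum_l cometric c x k l *
    (cderiv c i (fun y => g c y j l) x + cderiv c j (fun y => g c y i l) x
     - cderiv c l (fun y => g c y i j) x).

(* trace_g (nabla du) *)
Definition laplacian c (u : M -> R) x : R :=
  \sum_i \sum_j cometric c x i j *
    (cderiv c i (cderiv c j u) x - \sum_k christoffel c x i j k * cderiv c k u x).

Definition harmonic_on (U : set M) (u : M -> R) := C2_on U u /\
  forall c x, chart_at c x -> U x -> laplacian c u x = 0.

(* the endomorphism nabla_{d_i} F, from                                        *)
(* (nabla_{d_i} F)(d_j) = nabla_{d_i} (F d_j) - F (nabla_{d_i} d_j)            *)
Definition nabla_endo F c x (i : 'I_m) : 'M[R]_m := \matrix_(j, k)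
  (cderiv c i (fun y => F c y j k) x
   + \sum_l F c x j l * christoffel c x i l k
   - \sum_l christoffel c x i j l * F c x l k).

Definition covariant_endo F c x (X : 'rV[R]_m) : 'M[R]_m :=
  \sum_i X 0 i *: nabla_endo F c x i.

(* trace_g (nabla F); see divergence_frame *)
Definition divergence F c x : 'rV[R]_m :=
  \sum_i \sum_j cometric c x i j *: row j (nabla_endo F c x i).

Definition cosymplectic F :=
  forall c x, chart_at c x -> divergence F c x *m F c x = 0.

Lemma metric_unit c x : chart_at c x -> g c x \in unitmx.
Proof.
move=> cx; rewrite -row_free_unit -kermx_eq0; apply/rowV0P => v /sub_kermxP v0.
apply/eqP; apply/negPn/negP => /(metric_pos g cx).
by rewrite v0 mul0mx mxE ltxx.
Qed.

Lemma divergence_frame F c x (E : 'M[R]_m) : chart_at c x ->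
  (forall a b, pairing c x (row a E) (row b E) = (a == b)%:R) ->
  divergence F c x = \sum_a row a E *m covariant_endo F c x (row a E).
Proof.
move=> cx orthE.
have EgE : E *m (g c x *m E^T) = 1%:M.
  apply/matrixP => a b; rewrite [RHS]mxE -orthE /pairing -mulmxA !mxE.
  apply: eq_bigr => i _; rewrite !mxE; congr (_ * _).
  by apply: eq_bigr => j _; rewrite !mxE.
have := metric_unit cx => gU.
have -> : divergence F c x = \sum_i \sum_j (E^T *m E) i j *:
    row j (nabla_endo F c x i).
  suff -> : E^T *m E = cometric c x by [].
  have := mulmx1C EgE; rewrite -mulmxA => /(congr1 (mulmx (cometric c x))).
  by rewrite /cometric (mulKmx gU) mulmx1.
rewrite /covariant_endo.
under [RHS]eq_bigr do rewrite mulmx_sumr.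
rewrite [RHS]exchange_big; apply: eq_bigr => i _.
under [RHS]eq_bigr do rewrite -scalemxAr mulmx_sum_row scaler_sumr.
rewrite [RHS]exchange_big; apply: eq_bigr => j _ /=.
rewrite mxE scaler_suml; apply: eq_bigr => a _.
by rewrite scalerA !mxE.
Qed.

Lemma cderiv_metric_sym c x (k i j : 'I_m) : chart_at c x ->
  cderiv c k (fun y => g c y i j) x = cderiv c k (fun y => g c y j i) x.
Proof.
move=> [ca cx]; apply: near_eq_derive; near=> u => /=.
have [y yc <-] : (c @` chart_dom c) u.
  near: u; apply: open_nbhs_nbhs; split; first exact: chart_codom_open.
  by exists x.
by rewrite (chart_mapK yc) -[in LHS](metric_sym g (conj ca yc)) mxE.
Unshelve. all: by end_near. Qed.

Lemma christoffel_torsion_free c x (i j k : 'I_m) : chart_at c x ->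
  christoffel c x i j k = christoffel c x j i k.
Proof.
move=> cx; congr (_ * _); apply: eq_bigr => l _; congr (_ * (_ - _)).
  exact: addrC.
exact: cderiv_metric_sym.
Qed.

Lemma christoffel_metric c x (k i j : 'I_m) : chart_at c x ->
  cderiv c k (fun y => g c y i j) x =
    \sum_l christoffel c x k i l * g c x l j
    + \sum_l christoffel c x k j l * g c x i l.
Proof.
move=> cx.
have key (a b e : 'I_m) : \sum_l christoffel c x a b l * g c x l e =
    2^-1 * (cderiv c a (fun y => g c y b e) x
     + cderiv c b (fun y => g c y a e) x - cderiv c e (fun y => g c y a b) x).
  pose w := \row_l (cderiv c a (fun y => g c y b l) x
     + cderiv c b (fun y => g c y a l) x - cderiv c l (fun y => g c y a b) x).
  have symC : (cometric c x)^T = cometric c x.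
    by rewrite /cometric trmx_inv (metric_sym g cx).
  transitivity ((2^-1 *: (w *m cometric c x *m g c x)) 0 e).
    rewrite [in RHS]scalemxAl mxE; apply: eq_bigr => l _.
    congr (_ * _); rewrite !mxE; congr (_ * _); apply: eq_bigr => p _.
    by rewrite mulrC mxE; congr (_ * _); rewrite -[in LHS]symC mxE.
  by rewrite mulmxKV ?metric_unit // !mxE.
under [X in _ = _ + X]eq_bigr => l _ do
  rewrite -[in X in _ * X](metric_sym g cx) mxE.
rewrite !key (cderiv_metric_sym k j i cx) -mulrDr.
set a := cderiv c k _ x; set b := cderiv c i _ x; set d := cderiv c j _ x.
by field.
Qed.

End RiemannianGeometry.

(* multiplication by i on C^n = R^(n + n), with coordinates x + i y <-> (x, y) *)
Definition standard_J (R : realType) (n : nat) : 'M[R]_(n + n) :=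
  block_mx 0 1%:M (- 1%:M) 0.

(* Integrability: J comes from an atlas of complex charts. *)
Record complex_structure (R : realType) (n : nat)
    (N : smooth_manifold R (n + n)) := ComplexStructure {
  complex_endo :> endo_field N;
  complex_endo_sqr : forall d y, chart_at d y ->
    complex_endo d y *m complex_endo d y = - 1%:M;
  complex_integrable : forall y, exists2 d, chart_at d y &
    forall z, chart_dom d z -> complex_endo d z = standard_J R n
}.

Section PseudoHarmonicMorphisms.
Context {R : realType} {m n : nat}.
Context {M : smooth_manifold R m} {N : smooth_manifold R (n + n)}.
Variables (g : riemannian_metric M) (J : complex_structure N).
Variables (h : riemannian_metric N) (phi : M -> N).
Implicit Types (c : chart R M m) (d : chart R N (n + n)).

Definition hermitian_metric := forall d y, chart_at d y ->
  forall X Y, pairing h d y (X *m J d y) (Y *m J d y) = pairing h d y X Y.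

Definition complex_differential (f : N -> R[i]) d (y : N)
    (X : 'rV[R]_(n + n)) : R[i] :=
  Complex ('d (fun u => complex.Re (f (chart_inv d u))) (d y) X)
          ('d (fun u => complex.Im (f (chart_inv d u))) (d y) X).

Definition holomorphic_on (U : set N) (f : N -> R[i]) :=
  [/\ smooth_on U (fun y => complex.Re (f y)),
      smooth_on U (fun y => complex.Im (f y)) &
      forall d y, chart_at d y -> U y -> forall X,
        complex_differential f d y (X *m J d y) =
        'i%C * complex_differential f d y X].

Definition pseudo_harmonic_morphism :=
  forall (U : set N) (f : N -> R[i]), open U -> holomorphic_on U f ->
    harmonic_on g (phi @^-1` U) (fun x => complex.Re (f (phi x))) /\
    harmonic_on g (phi @^-1` U) (fun x => complex.Im (f (phi x))).

Definition is_adjoint c d x (A : 'M[R]_(n + n, m)) := forall X E,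
  pairing g c x X (E *m A) =
  pairing h d (phi x) (X *m differential_mx phi c d x) E.

Definition PHWC := forall c d x, chart_at c x -> chart_at d (phi x) ->
  exists2 A, is_adjoint c d x A &
    comm_mx (A *m differential_mx phi c d x) (J d (phi x)).

Definition vertical c d x (X : 'rV[R]_m) := X *m differential_mx phi c d x = 0.

Definition horizontal c d x (X : 'rV[R]_m) :=
  forall V, vertical c d x V -> pairing g c x X V = 0.

(* F = 0 on vertical vectors, and F = (dphi|_H)^-1 o J o dphi|_H on the space  *)
(* H of horizontal vectors; see induced_f_structure_unique                     *)
Definition induced_f_structure (F : endo_field M) :=
  forall c d x, chart_at c x -> chart_at d (phi x) ->
    (forall X, vertical c d x X -> X *m F c x = 0) /\
    (forall X, horizontal c d x X -> horizontal c d x (X *m F c x) /\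
       X *m F c x *m differential_mx phi c d x =
       X *m differential_mx phi c d x *m J d (phi x)).

Lemma vertical_horizontal_split c d x (X : 'rV[R]_m) : submersion phi ->
  chart_at c x -> chart_at d (phi x) ->
  exists V H, [/\ X = V + H, vertical c d x V & horizontal c d x H].
Proof.
move=> [_ surj] cx dx; have fullD := surj c d x cx dx.
set D := differential_mx phi c d x in fullD.
pose A := D^T *m cometric g c x; have gU := metric_unit g cx.
have AgE : A *m g c x = D^T by rewrite mulmxKV.
have ADU : A *m D \in unitmx.
  rewrite -row_free_unit -kermx_eq0; apply/rowV0P => v /sub_kermxP vAD0.
  have wD0 : v *m A *m D = 0 by rewrite -mulmxA.
  have w0 : v *m A = 0.
    apply/eqP; apply/negPn/negP => /(metric_pos g cx).
    rewrite -(mulmxA v A) AgE -mulmxA -trmx_mul wD0 trmx0 mulmx0.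
    by rewrite mxE ltxx.
  have DTfree : row_free D^T by rewrite /row_free mxrank_tr.
  by apply: (row_free_inj DTfree); rewrite mul0mx -AgE mulmxA w0 mul0mx.
pose H := X *m D *m invmx (A *m D) *m A.
exists (X - H), H; split; first by rewrite subrK.
  by rewrite /vertical -/D mulmxBl /H -[_ *m A *m D]mulmxA (mulmxKV ADU) subrr.
move=> V; rewrite /vertical -/D => VD0.
by rewrite /pairing /H -[_ *m A *m g c x]mulmxA AgE -mulmxA -trmx_mul VD0
  trmx0 mulmx0 mxE.
Qed.

Lemma induced_f_structure_unique (F F' : endo_field M) : submersion phi ->
  induced_f_structure F -> induced_f_structure F' ->
  forall c x, chart_at c x -> F c x = F' c x.
Proof.
move=> sub indF indF' c x cx; have [d da dx] := atlas_cover (phi x).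
have dphix : chart_at d (phi x) by [].
have [F0 FH] := indF _ _ _ cx dphix; have [F'0 F'H] := indF' _ _ _ cx dphix.
apply/row_matrixP => i; rewrite !rowE.
have [V [H [-> V0 HH]]] := vertical_horizontal_split (delta_mx 0 i) sub cx dphix.
rewrite !mulmxDl F0 // F'0 // !add0r.
have [hF eF] := FH _ HH; have [hF' eF'] := F'H _ HH.
apply/eqP; rewrite -subr_eq0; apply/negPn/negP => /(metric_pos g cx).
set W := _ - _; have WE : W = H *m F c x - H *m F' c x by [].
have WV : vertical c d x W by rewrite /vertical mulmxBl eF eF' subrr.
have := hF _ WV; have := hF' _ WV; rewrite /pairing => w' w.
have -> : (W *m g c x *m W^T) 0 0 = 0
  by rewrite {1}WE !mulmxBl [LHS]mxE [X in _ + X]mxE w w' subrr.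
by rewrite ltxx.
Qed.

End PseudoHarmonicMorphisms.

(* Main.v *)
(* Let D be the matrix of the differential of phi in a chart c of M and a complex
   chart d of N, J0 the constant matrix of J in d, and P = D^T g^-1 D the matrix of
   the products <d phi^a, d phi^b>.  For f on N,
     Delta (f o phi) = tr (P Hess f) + \sum_a (d_a f) (Delta phi^a).
   Testing this on f = z_a and f = z_a z_b shows that a pseudo-harmonic morphism has
   harmonic components phi^a and a matrix P commuting with J0; for a Hermitian h the
   latter says that phi is PHWC.  Conversely, the Hessian of the real or imaginary
   part of a holomorphic f anticommutes with J0, so tr (P Hess f) = 0 as soon as P
   commutes with J0.  It remains to compare the Delta phi^a with div F:
   differentiating F D = D J0 and tracing gives (div F) D = (Delta phi) J0, because
   g^-1 F is skew and the Hessians of the phi^a are symmetric.  Hence div F is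
   vertical, i.e. F div F = 0, if and only if all Delta phi^a vanish. *)

Require Import Defs.
From mathcomp Require Import all_boot all_order all_algebra complex.
From mathcomp Require Import all_classical all_reals all_analysis ring lra.

Set Implicit Arguments.
Unset Strict Implicit.
Unset Printing Implicit Defensive.

Import Order.TTheory GRing.Theory Num.Theory numFieldNormedType.Exports.

(** * Functions of class C^k *)

(** The matrix of J is constant only in complex charts, whereas PHWC is demanded in all charts, and
    commutation of P with J depends on the chart because P is a bilinear form on covectors. The
    tensorial form of the condition is P J + J^T P = 0, which is commutation wherever J^T = -J. It
    no longer contains h: the adjoint of D is h D^T g^-1, so D* D is h P, and h intertwines J with
    -J^T. The right-hand side also asserts that F exists as a smooth field. The candidate is D J
    P^-1 D^T g^-1, in which P^-1 D^T g^-1 is the horizontal lift. It does not depend on the chart of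
    N, so local formulas glue, and uniqueness of the induced structure identifies any given F with
    it. This gives the explicit matrix at all points near x, which is what differentiating F D = D J
    requires. *)

Section NearEq.
Local Open Scope classical_set_scope.
Local Open Scope ring_scope.
Context {R : realType} {V W : normedModType R}.

Lemma near_eq_differentiable (f g : V -> W) (x : V) :
  (\near x, f x = g x) -> differentiable f x -> differentiable g x.
Proof.
move=> fg df; have fgx := nbhs_singleton fg.
have [cf /eqaddoP ef] := (diff_locallyP _ _).1 df.
(* The differential of [f] is first shown to satisfy the expansion of [g]; [diff_unique] then
   identifies it with the differential of [g]. *)
have eg : g \o shift x = cst (g x) + 'd f x +o_ (0 : V) id.
  apply/eqaddoP => e e0; have := ef e e0.
  have fg0 : \forall h \near (0 : V), f (h + x) = g (h + x).
    move: fg; rewrite (near_shift (0 : V)); apply: filterS => h /=.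
    by rewrite subr0.
  apply: filterS2 fg0 => h /= fgh.
  by rewrite !fctE /= fgh fgx.
by apply/diff_locallyP; rewrite (diff_unique cf eg).
Qed.

Lemma near_eq_continuous (f g : V -> W) (x : V) :
  (\near x, f x = g x) -> {for x, continuous f} -> {for x, continuous g}.
Proof.
move=> fg; rewrite /prop_for /continuous_at (nbhs_singleton fg) => cf.
by apply: cvg_trans cf; apply: near_eq_cvg; apply: filterS fg => y ->.
Qed.

Lemma open_near_eq (f g : V -> W) (U : set V) (x : V) : open U -> U x ->
  (forall y, U y -> f y = g y) -> \near x, f x = g x.
Proof.
move=> oU Ux fg; near=> y; apply: fg; near: y.
by apply: open_nbhs_nbhs; split.
Unshelve. all: by end_near. Qed.

End NearEq.

Section RowVector.
Local Open Scope classical_set_scope.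
Local Open Scope ring_scope.
Context {R : realType} {V : normedModType R} {n : nat}.
Implicit Types f : V -> 'rV[R]_n.

Lemma row_fun_sum f : f = \sum_j (fun x => f x 0 j *: delta_mx 0 j).
Proof. by apply/funext => x; rewrite fct_sumE [LHS]row_sum_delta. Qed.

Lemma differentiable_row f x :
  (forall j, differentiable (fun y => f y 0 j) x) -> differentiable f x.
Proof.
move=> df; rewrite (row_fun_sum f); apply: differentiable_sum => j.
exact: differentiableZl.
Qed.

Lemma continuous_row f x :
  (forall j, {for x, continuous (fun y => f y 0 j)}) -> {for x, continuous f}.
Proof.
move=> cf; rewrite (row_fun_sum f); elim/big_ind: _ => [|u v cu cv|j _].
- exact: cst_continuous.
- exact: (continuousD cu cv).
- exact: continuousZr_tmp.
Qed.

Lemma differentiable_row_coord f x j :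
  differentiable f x -> differentiable (fun y => f y 0 j) x.
Proof.
move=> df; apply: (differentiable_comp (g := fun M : 'rV[R]_n => M 0 j)) => //.
exact: differentiable_coord.
Qed.

Lemma diff_row_coord f x j v : differentiable f x ->
  'd (fun y => f y 0 j) x v = ('d f x v) 0 j.
Proof.
move=> df; rewrite -!deriveE //; last exact: differentiable_row_coord.
by rewrite derive_mx ?mxE//; exact: diff_derivable.
Qed.

End RowVector.

Section CkFunctions.
Local Open Scope classical_set_scope.
Local Open Scope ring_scope.
Context {R : realType} {m : nat}.
Implicit Types (U V : set 'rV[R]_m) (f g : 'rV[R]_m -> R) (k : nat) (u : 'rV[R]_m).

Lemma partialE i f u : differentiable f u -> partial i f u = 'd f u (delta_mx 0 i).
Proof. exact: deriveE. Qed.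

Lemma diff_partial f u (X : 'rV[R]_m) : differentiable f u ->
  'd f u X = \sum_i X 0 i * partial i f u.
Proof.
move=> df; rewrite {1}(row_sum_delta X) linear_sum; apply: eq_bigr => i _.
by rewrite linearZ partialE.
Qed.

Lemma partial_near i f g u : (\near u, f u = g u) -> partial i f u = partial i g u.
Proof. exact: near_eq_derive. Qed.

Lemma partial_cst i (a : R) u : partial i (fun=> a) u = 0.
Proof. exact: derive_cst. Qed.

Lemma partialD i f g u : differentiable f u -> differentiable g u ->
  partial i (fun u => f u + g u) u = partial i f u + partial i g u.
Proof. by move=> df dg; rewrite /partial deriveD//; exact: diff_derivable. Qed.

Lemma partialN i f u : differentiable f u ->
  partial i (fun u => - f u) u = - partial i f u.
Proof. by move=> df; rewrite /partial deriveN//; exact: diff_derivable. Qed.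

Lemma partialM i f g u : differentiable f u -> differentiable g u ->
  partial i (fun u => f u * g u) u = partial i f u * g u + f u * partial i g u.
Proof.
move=> df dg; rewrite /partial [LHS]deriveM; try exact: diff_derivable.
by rewrite addrC; congr (_ + _); rewrite mulrC.
Qed.

Lemma partialV i f u : differentiable f u -> f u != 0 ->
  partial i (fun u => (f u)^-1) u = - ((f u)^-1 * (f u)^-1 * partial i f u).
Proof.
move=> df f0; rewrite /partial deriveV//; last exact: diff_derivable.
by rewrite /GRing.scale/= mulNr expr2 invfM.
Qed.

Lemma differentiable_fsum I (r : seq I) (f : I -> 'rV[R]_m -> R) u :
  (forall j, differentiable (f j) u) -> differentiable (fun u => \sum_(j <- r) f j u) u.
Proof.
move=> df; elim: r => [|j r IH].
  by under eq_fun do rewrite big_nil; exact: differentiable_cst.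
by under eq_fun do rewrite big_cons; apply: differentiableD.
Qed.

Lemma partial_sum I (r : seq I) i (f : I -> 'rV[R]_m -> R) u :
  (forall j, differentiable (f j) u) ->
  partial i (fun u => \sum_(j <- r) f j u) u = \sum_(j <- r) partial i (f j) u.
Proof.
move=> df; elim: r => [|j r IH].
  by under eq_fun do rewrite big_nil; rewrite partial_cst big_nil.
under eq_fun do rewrite big_cons.
by rewrite partialD ?big_cons ?IH//; exact: differentiable_fsum.
Qed.

Lemma is_Ck_subset k U V f : V `<=` U -> is_Ck k U f -> is_Ck k V f.
Proof.
elim: k f => [|k IH] f VU /=; first by move=> cf u /VU; exact: cf.
by move=> [df pf]; split=> [u /VU|i]; [exact: df|exact: IH].
Qed.

(** [is_Ck] speaks about each point of its set separately, its derivatives being total functions.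
    This lets the charts that express a function vary with the point. *)
Lemma is_Ck_local k U f :
  (forall u, U u -> exists2 V, V u & is_Ck k V f) -> is_Ck k U f.
Proof.
elim: k f => [|k IH] f loc /=; first by move=> u /loc[V Vu]; apply.
split=> [u /loc[V Vu [df _]]|i]; first exact: df.
by apply: IH => u /loc[V Vu [_ pf]]; exists V => //; exact: pf.
Qed.

(** Openness makes the two functions equal near each point of [U], so their derivatives agree there.
    This discards the arbitrary values that [chart_inv] and [invmx] take elsewhere. *)
Lemma is_Ck_eq k U f g : open U -> (forall u, U u -> f u = g u) ->
  is_Ck k U f -> is_Ck k U g.
Proof.
move=> oU; elim: k f g => [|k IH] f g fg /=.
  move=> cf u Uu; apply: near_eq_continuous (cf u Uu).
  exact: open_near_eq fg.
move=> [df pf]; split=> [u Uu|i].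
  by apply: near_eq_differentiable (df u Uu); exact: open_near_eq fg.
by apply: IH (pf i) => u Uu; apply: partial_near; exact: open_near_eq fg.
Qed.

Lemma is_Ck_differentiable k U f u : is_Ck k.+1 U f -> U u -> differentiable f u.
Proof. by move=> [df _]; exact: df. Qed.

Lemma is_CkW k U f : is_Ck k.+1 U f -> is_Ck k U f.
Proof.
elim: k f => [|k IH] f [df pf].
  by move=> u Uu; exact: differentiable_continuous (df u Uu).
by split=> // i; exact: IH.
Qed.

Lemma is_Ck_cst k U (a : R) : is_Ck k U (fun=> a).
Proof.
elim: k a => [|k IH] a /=; first by move=> u _; exact: cst_continuous.
split=> [u _|i]; first exact: differentiable_cst.
rewrite (_ : partial i _ = fun=> 0)//.
by apply/funext => u; exact: partial_cst.
Qed.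

Lemma is_CkD k U f g : open U -> is_Ck k U f -> is_Ck k U g ->
  is_Ck k U (fun u => f u + g u).
Proof.
move=> oU; elim: k f g => [|k IH] f g /=.
  by move=> cf cg u Uu; exact: (continuousD (cf u Uu) (cg u Uu)).
move=> [df pf] [dg pg]; split=> [u Uu|i]; first exact: differentiableD (df u Uu) (dg u Uu).
by apply: is_Ck_eq (IH _ _ (pf i) (pg i)) => // u Uu; rewrite partialD //; auto.
Qed.

Lemma is_CkM k U f g : open U -> is_Ck k U f -> is_Ck k U g ->
  is_Ck k U (fun u => f u * g u).
Proof.
move=> oU; elim: k f g => [|k IH] f g.
  by move=> cf cg u Uu; exact: (continuousM (cf u Uu) (cg u Uu)).
move=> Cf Cg; have [[df pf] [dg pg]] := (Cf, Cg).
split=> [u Uu|i]; first exact: differentiableM (df u Uu) (dg u Uu).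
(* The Leibniz rule pairs each derivative with an undifferentiated factor, which has one order to
   spare. *)
have CkD := is_CkD oU (IH _ _ (pf i) (is_CkW Cg)) (IH _ _ (is_CkW Cf) (pg i)).
by apply: is_Ck_eq CkD => // u Uu; rewrite partialM //; auto.
Qed.

Lemma is_CkN k U f : open U -> is_Ck k U f -> is_Ck k U (fun u => - f u).
Proof.
move=> oU Cf; apply: is_Ck_eq (is_CkM oU (is_Ck_cst k U (-1)) Cf) => // u _.
by rewrite mulN1r.
Qed.

Lemma is_Ck_sum k U I (r : seq I) (f : I -> 'rV[R]_m -> R) : open U ->
  (forall j, is_Ck k U (f j)) -> is_Ck k U (fun u => \sum_(j <- r) f j u).
Proof.
move=> oU Cf; elim: r => [|j r IH].
  by under eq_fun do rewrite big_nil; exact: is_Ck_cst.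
by under eq_fun do rewrite big_cons; exact: is_CkD.
Qed.

Lemma is_Ck_prod k U I (r : seq I) (f : I -> 'rV[R]_m -> R) : open U ->
  (forall j, is_Ck k U (f j)) -> is_Ck k U (fun u => \prod_(j <- r) f j u).
Proof.
move=> oU Cf; elim: r => [|j r IH].
  by under eq_fun do rewrite big_nil; exact: is_Ck_cst.
by under eq_fun do rewrite big_cons; exact: is_CkM.
Qed.

Lemma is_CkV k U f : open U -> (forall u, U u -> f u != 0) -> is_Ck k U f ->
  is_Ck k U (fun u => (f u)^-1).
Proof.
move=> oU f0; elim: k => [|k IH].
  by move=> cf u Uu; exact: (continuousV (f0 u Uu) (cf u Uu)).
move=> Cf; have [df pf] := Cf.
split=> [u Uu|i]; first exact: differentiableV (df u Uu) (f0 u Uu).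
have CV := IH (is_CkW Cf).
apply: is_Ck_eq (is_CkN oU (is_CkM oU (is_CkM oU CV CV) (pf i))) => // u Uu.
by rewrite partialV; auto.
Qed.

End CkFunctions.

Section CkComposition.
Local Open Scope classical_set_scope.
Local Open Scope ring_scope.
Context {R : realType} {m n : nat}.

Lemma partial_comp i (f : 'rV[R]_n -> R) (g : 'rV[R]_m -> 'rV[R]_n) u :
  differentiable g u -> differentiable f (g u) ->
  partial i (f \o g) u =
    \sum_l partial l f (g u) * partial i (fun u => g u 0 l) u.
Proof.
move=> dg df; rewrite (partialE _ (differentiable_comp dg df)) (diff_comp dg df).
rewrite /= diff_partial//; apply: eq_bigr => l _; rewrite mulrC; congr (_ * _).
by rewrite (partialE _ (differentiable_row_coord l dg)) diff_row_coord.
Qed.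

Lemma is_Ck_comp k (U : set 'rV[R]_m) (V : set 'rV[R]_n) f
    (g : 'rV[R]_m -> 'rV[R]_n) : open U -> g @` U `<=` V ->
  (forall j, is_Ck k U (fun u => g u 0 j)) -> is_Ck k V f -> is_Ck k U (f \o g).
Proof.
move=> oU gUV; have gV u : U u -> V (g u) by move=> Uu; apply: gUV; exists u.
elim: k f => [|k IH] f Cg Cf.
  move=> u Uu; apply: continuous_comp; last exact: Cf (gV _ Uu).
  by apply: continuous_row => j; exact: Cg.
have dg u : U u -> differentiable g u.
  by move=> Uu; apply: differentiable_row => j; exact: is_Ck_differentiable (Cg j) Uu.
have df u : U u -> differentiable f (g u).
  by move=> Uu; exact: is_Ck_differentiable Cf (gV _ Uu).
split=> [u Uu|i]; first exact: differentiable_comp (dg u Uu) (df u Uu).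
have pf l : is_Ck k V (partial l f) by have [_ pf] := Cf; exact: pf.
have pg l : is_Ck k U (partial i (fun u => g u 0 l)).
  by have [_ pg] := Cg l; exact: pg.
have CD : is_Ck k U (fun u => \sum_l partial l f (g u) * partial i (fun u => g u 0 l) u).
  apply: is_Ck_sum => // l; apply: is_CkM => //.
  by apply: IH => // j; exact: is_CkW.
by apply: is_Ck_eq CD => // u Uu; rewrite partial_comp; auto.
Qed.

End CkComposition.

(** * Symmetry of second partial derivatives *)

Section Schwarz.
Local Open Scope classical_set_scope.
Local Open Scope ring_scope.
Context {R : realType} {m : nat}.
Implicit Types (U : set 'rV[R]_m) (f : 'rV[R]_m -> R) (u v w : 'rV[R]_m).

Lemma is_derive_line f w v (t : R) : differentiable f (w + t *: v) ->
  is_derive t 1 (fun s : R => f (w + s *: v)) ('D_v f (w + t *: v)).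
Proof.
move=> df; pose L := (cst w + ( *:%R^~ v) : R -> 'rV[R]_m).
have dL : is_diff t L (0 + ( *:%R^~ v)) by exact: is_diffD.
have [dLt valL] := dL.
have dfL : differentiable (f \o L) t by exact: differentiable_comp.
apply: DeriveDef; first exact: (diff_derivable (f := f \o L)).
rewrite [LHS](deriveE (f := f \o L))// (diff_comp dLt df)/= valL.
by rewrite !fctE add0r scale1r deriveE.
Qed.

Lemma MVT_line f w v (r : R) : 0 < r ->
  (forall t, 0 <= t <= r -> differentiable f (w + t *: v)) ->
  exists2 t, 0 <= t <= r & f (w + r *: v) - f w = 'D_v f (w + t *: v) * r.
Proof.
move=> r0 df.
have [t||t] := @MVT R (fun s => f (w + s *: v)) (fun s => 'D_v f (w + s *: v)) 0 r r0.
- by rewrite in_itv /= => /andP[t0 tr]; apply/is_derive_line/df; rewrite !ltW.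
- apply: continuous_in_subspaceT => t; rewrite inE/= in_itv/= => tr.
  apply: differentiable_continuous; apply/derivable1_diffP.
  by have [] := is_derive_line (df t tr).
- rewrite in_itv/= => /andP[t0 tr] E; exists t; first by rewrite !ltW.
  by move: E; rewrite scale0r addr0 subr0.
Qed.

Lemma derive_translate f v w u :
  'D_v (f \o shift w) u = 'D_v f (u + w).
Proof. by rewrite /derive /=; under eq_fun do rewrite -addrA. Qed.

(** The mean value theorem is used twice: on the increment [G z] in direction [w], moved along [v],
    whose derivative is an increment of ['D_v f]; then on ['D_v f] along [w]. *)
Lemma second_difference f u v w (r : R) : 0 < r ->
  (forall s t, 0 <= s <= r -> 0 <= t <= r ->
    differentiable f (u + s *: v + t *: w) /\
    differentiable ('D_v f) (u + s *: v + t *: w)) ->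
  exists s t, [/\ 0 <= s <= r, 0 <= t <= r &
    f (u + r *: v + r *: w) - f (u + r *: v) - (f (u + r *: w) - f u) =
    'D_w ('D_v f) (u + s *: v + t *: w) * r * r].
Proof.
move=> r0 df; have r00 : (0 : R) <= 0 <= r by rewrite lexx ltW.
have rrr : 0 <= r <= r by rewrite lexx ltW.
pose G z := f (z + r *: w) - f z.
have dsh z : differentiable f (z + r *: w) -> differentiable (f \o shift (r *: w)) z.
  by move=> dfz; apply: differentiable_comp.
have dG s : 0 <= s <= r -> differentiable f (u + s *: v + r *: w) /\
    differentiable f (u + s *: v).
  move=> sr; split; first by have [] := df _ _ sr rrr.
  by have [] := df _ _ sr r00; rewrite scale0r addr0.
have [s sr|s sr Gs] := @MVT_line G u v r r0.
  by have [d1 d2] := dG s sr; apply: differentiableB => //; exact: dsh.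
have [d1 d2] := dG s sr.
have [t tr|t tr Ht] := @MVT_line ('D_v f) (u + s *: v) w r r0.
  by have [] := df _ _ sr tr.
exists s, t; split=> //; rewrite -Ht; move: Gs; rewrite /G => ->; congr (_ * _).
have dd2 := diff_derivable (v := v) d2.
have dd1 := diff_derivable (v := v) (dsh _ d1).
rewrite [LHS](deriveB dd1 dd2); congr (_ - _).
exact: derive_translate.
Qed.

(** The second difference over a small parallelogram is symmetric in its two sides. Hence the two
    mixed derivatives agree when taken at suitable points of it, and continuity moves both points to
    [u]. *)
Lemma partialC U f i j u : open U -> U u -> is_Ck 2 U f ->
  partial i (partial j f) u = partial j (partial i f) u.
Proof.
move=> oU Uu Cf; have [df pf] := Cf.
have c2 a b : {for u, continuous (partial a (partial b f))}.
  by have [_ /(_ a)] := pf b; exact.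
apply/eqP; rewrite -subr_eq0 -normr_eq0; apply/eqP/le_anti; rewrite normr_ge0 andbT.
apply/ler_addgt0Pr => e e0; rewrite add0r.
pose v := delta_mx 0 i : 'rV[R]_m; pose w := delta_mx 0 j : 'rV[R]_m.
have e20 : 0 < e / 2 by rewrite divr_gt0.
have nU : nbhs u U by exact: open_nbhs_nbhs.
have /cvgr_dist_lt/(_ _ e20) n1 := c2 i j.
have /cvgr_dist_lt/(_ _ e20) n2 := c2 j i.
have [d /= d0 dP] := (nbhs_ballP _ _).1 (filterI nU (filterI n1 n2)).
(* The summand 1 makes [K] positive and the norm estimate strict, so that the parallelogram with
   sides [r *: v] and [r *: w] lies in the ball of radius [d]. *)
pose K := `|v| + `|w| + 1.
have K0 : 0 < K by rewrite /K ltr_wpDl// addr_ge0.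
pose r := d / K; have r0 : 0 < r by rewrite divr_gt0.
have inb s t : 0 <= s <= r -> 0 <= t <= r -> ball u d (u + s *: v + t *: w).
  move=> /andP[s0 sr] /andP[t0 tr].
  rewrite -ball_normE/= -addrA opprD addrA subrr add0r normrN.
  apply: (le_lt_trans (ler_normD _ _)); rewrite !normrZ !ger0_norm//.
  apply: (@le_lt_trans _ _ (r * `|v| + r * `|w|)).
    by apply: lerD; apply: ler_wpM2r.
  by rewrite -mulrDr /r mulrAC ltr_pdivrMr// ltr_pM2l// /K ltrDl.
have [s t sr tr|s [t [sr tr E1]]] := @second_difference f u v w r r0.
  have [Uy _] := dP _ (inb s t sr tr); split; first exact: df.
  by have [dpf _] := pf i; exact: dpf.
have [t' s' tr' sr'|t' [s' [tr' sr' E2]]] := @second_difference f u w v r r0.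
  rewrite addrAC; have [Uy _] := dP _ (inb s' t' sr' tr'); split; first exact: df.
  by have [dpf _] := pf j; exact: dpf.
have E12 : 'D_w ('D_v f) (u + s *: v + t *: w) * r * r =
          'D_v ('D_w f) (u + t' *: w + s' *: v) * r * r.
  apply: etrans (esym E1) _; apply: etrans _ E2.
  by rewrite [u + r *: w + r *: v]addrAC; ring.
have rn0 : r != 0 by rewrite gt_eqF.
have E := mulIf rn0 (mulIf rn0 E12).
have [_ [_ B1]] := dP _ (inb s t sr tr).
have inb' : ball u d (u + t' *: w + s' *: v) by rewrite addrAC; exact: inb.
have [_ [B2 _]] := dP _ inb'.
pose x := 'D_w ('D_v f) u; pose y := 'D_v ('D_w f) u.
pose z := 'D_v ('D_w f) (u + t' *: w + s' *: v).
have b1 : `|x - z| < e / 2 by rewrite /z -E; exact: B1.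
have b2 : `|y - z| < e / 2 by exact: B2.
suff : `|y - x| <= e by [].
rewrite (splitr e) -(subrKA z); apply: le_trans (ler_normD _ _) _.
by apply: lerD; apply: ltW; [exact: b2|rewrite distrC; exact: b1].
Qed.

End Schwarz.

(** * Charts and differentials *)

Section SmoothMatrices.
Local Open Scope classical_set_scope.
Local Open Scope ring_scope.
Context {R : realType} {m : nat}.
Implicit Types U : set 'rV[R]_m.

Definition smooth_mx p q U (A : 'rV[R]_m -> 'M[R]_(p, q)) :=
  forall i j, is_smooth U (fun u => A u i j).

Lemma smooth_mxM p q r U (A : 'rV[R]_m -> 'M[R]_(p, q))
    (B : 'rV[R]_m -> 'M[R]_(q, r)) :
  open U -> smooth_mx U A -> smooth_mx U B -> smooth_mx U (fun u => A u *m B u).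
Proof.
move=> oU sA sB i j k; under eq_fun do rewrite mxE.
by apply: is_Ck_sum => // l; apply: is_CkM => //; [exact: sA|exact: sB].
Qed.

Lemma smooth_mxT p q U (A : 'rV[R]_m -> 'M[R]_(p, q)) :
  smooth_mx U A -> smooth_mx U (fun u => (A u)^T).
Proof. by move=> sA i j k; under eq_fun do rewrite mxE; exact: sA. Qed.

Lemma smooth_det p U (A : 'rV[R]_m -> 'M[R]_p) :
  open U -> smooth_mx U A -> is_smooth U (fun u => \det (A u)).
Proof.
move=> oU sA k; apply: is_Ck_sum => // s; apply: is_CkM => //.
  exact: is_Ck_cst.
by apply: is_Ck_prod => // i; exact: sA.
Qed.

(** By Cramer's rule the entries are cofactors over the determinant; [invmx] has this form on
    invertible matrices only. *)
Lemma smooth_invmx p U (A : 'rV[R]_m -> 'M[R]_p) : open U ->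
  (forall u, U u -> A u \in unitmx) -> smooth_mx U A ->
  smooth_mx U (fun u => invmx (A u)).
Proof.
move=> oU Au sA i j k.
have dA u : U u -> \det (A u) != 0 by move=> /Au; rewrite unitmxE unitfE.
apply: (@is_Ck_eq _ _ _ _ (fun u => (\det (A u))^-1 * cofactor (A u) j i)) => //.
  by move=> u /Au Uu; rewrite /invmx Uu !mxE.
apply: is_CkM => //; first by apply: is_CkV => //; exact: smooth_det.
apply: is_CkM => //; first exact: is_Ck_cst.
apply: smooth_det => // i' j' k'; under eq_fun do rewrite !mxE.
exact: sA.
Qed.

End SmoothMatrices.

Section Jacobian.
Local Open Scope classical_set_scope.
Local Open Scope ring_scope.
Context {R : realType}.

Lemma jacobian_entry m n (f : 'rV[R]_m -> 'rV[R]_n) u i j : differentiable f u ->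
  jacobian f u i j = partial i (fun v => f v 0 j) u.
Proof.
move=> df; rewrite mxE (partialE _ (differentiable_row_coord j df)).
by rewrite diff_row_coord.
Qed.

Lemma jacobian_near m n (f g : 'rV[R]_m -> 'rV[R]_n) u :
  (\near u, f u = g u) -> differentiable f u -> jacobian f u = jacobian g u.
Proof.
move=> fg df; have dg := near_eq_differentiable fg df.
apply/matrixP => i j.
apply: etrans (jacobian_entry i j df) (etrans _ (esym (jacobian_entry i j dg))).
apply: partial_near.
by apply: filterS fg => v ->.
Qed.

Lemma jacobian_comp m n p (f : 'rV[R]_m -> 'rV[R]_n) (g : 'rV[R]_n -> 'rV[R]_p) u :
  differentiable f u -> differentiable g (f u) ->
  jacobian (g \o f) u = jacobian f u *m jacobian g (f u).
Proof.
move=> df dg; apply/row_matrixP => i; rewrite !rowE mulmxA.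
rewrite -(deriveEjacobian _ (differentiable_comp df dg)).
rewrite -(deriveEjacobian _ df) -(deriveEjacobian _ dg).
rewrite (deriveE _ (differentiable_comp df dg)) (deriveE _ df) (deriveE _ dg).
by rewrite (diff_comp df dg).
Qed.

Lemma jacobian_id m (u : 'rV[R]_m) : jacobian id u = 1%:M.
Proof.
have [did vid] := is_diff_id u.
by apply/row_matrixP => i; rewrite !rowE mul_rV_lin1 mulmx1 vid.
Qed.

End Jacobian.

Section Charts.
Local Open Scope classical_set_scope.
Local Open Scope ring_scope.
Context {R : realType} {m : nat} {M : topologicalType}.
Implicit Types (c d : chart R M m) (x : M) (U : set M).

(** Germs at [x] are moved to coordinates this way: the image of the chart is open, and continuity
    of [chart_inv] at [c x] keeps nearby points in the given neighbourhood. *)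
Lemma near_chart c x U : chart_dom c x -> nbhs x U ->
  \forall u \near c x,
    [/\ chart_dom c (chart_inv c u), U (chart_inv c u) & c (chart_inv c u) = u].
Proof.
move=> cx xU; have ox : (c @` chart_dom c) (c x) by exists x.
have n1 : nbhs (c x) (c @` chart_dom c).
  by apply: open_nbhs_nbhs; split=> //; exact: chart_codom_open.
have n2 : chart_inv c @ c x --> chart_inv c (c x) := chart_inv_continuous ox.
rewrite (chart_mapK cx) in n2.
apply: filterS2 n1 (n2 _ xU) => u [y yc <-] /=.
by rewrite (chart_mapK yc).
Qed.

Lemma chart_image_open c U : open U -> open (c @` (chart_dom c `&` U)).
Proof.
move=> oU; rewrite openE => _ [x [cx Ux] <-].
have xU : nbhs x U by exact: open_nbhs_nbhs.
apply: filterS (near_chart cx xU) => u [cu Uu cK].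
by exists (chart_inv c u).
Qed.

Lemma chart_image_invP c U u : (c @` (chart_dom c `&` U)) u ->
  [/\ chart_dom c (chart_inv c u), U (chart_inv c u) & c (chart_inv c u) = u].
Proof. by move=> [x [cx Ux] <-]; rewrite (chart_mapK cx). Qed.

End Charts.

Section DifferentialOfMap.
Local Open Scope classical_set_scope.
Local Open Scope ring_scope.
Context {R : realType} {m n : nat}.
Context {M : smooth_manifold R m} {N : smooth_manifold R n}.
Implicit Types (phi : M -> N) (c : chart R M m) (d : chart R N n).

Definition overlap phi c d : set 'rV[R]_m :=
  c @` (chart_dom c `&` phi @^-1` chart_dom d).

Lemma overlap_open phi c d : continuous phi -> open (overlap phi c d).
Proof.
move=> cphi; apply: chart_image_open.
by move/continuousP: cphi; apply; exact: chart_dom_open.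
Qed.

Lemma overlap_chart phi c d x : chart_dom c x -> chart_dom d (phi x) ->
  overlap phi c d (c x).
Proof. by move=> cx dx; exists x. Qed.

Lemma local_map_differentiable phi c d u : smooth_map phi -> atlas c -> atlas d ->
  overlap phi c d u -> differentiable (d \o phi \o chart_inv c) u.
Proof.
move=> [_ sphi] ac ad ou; apply: differentiable_row => j.
exact: is_Ck_differentiable (sphi c d ac ad j 1) ou.
Qed.

Lemma smooth_map_differentiable phi c d x : smooth_map phi -> chart_at c x ->
  chart_at d (phi x) -> differentiable (d \o phi \o chart_inv c) (c x).
Proof.
move=> sphi [ac cx] [ad dx]; apply: local_map_differentiable => //.
exact: overlap_chart.
Qed.

Lemma differential_mx_entry phi c d x i j : smooth_map phi -> chart_at c x ->
  chart_at d (phi x) ->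
  differential_mx phi c d x i j = cderiv c i (fun y => d (phi y) 0 j) x.
Proof.
move=> sphi cx dx; rewrite /differential_mx jacobian_entry//.
exact: smooth_map_differentiable.
Qed.

Lemma smooth_differential_mx phi c d : smooth_map phi -> atlas c -> atlas d ->
  smooth_mx (overlap phi c d) (fun u => differential_mx phi c d (chart_inv c u)).
Proof.
move=> sphi ac ad i j k; have [cphi Sphi] := sphi.
apply: is_Ck_eq (_ : is_Ck k _ (partial i (fun u => d (phi (chart_inv c u)) 0 j))).
- exact: overlap_open.
- move=> u ou; have [cu du cK] := chart_image_invP ou.
  by rewrite differential_mx_entry// /cderiv cK.
- by have [_] := Sphi c d ac ad j k.+1; exact.
Qed.

End DifferentialOfMap.

Section Transition.
Local Open Scope classical_set_scope.
Local Open Scope ring_scope.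
Context {R : realType} {m : nat} {M : smooth_manifold R m}.
Implicit Types (c d e : chart R M m) (x : M).

(** With it, changes of charts become differentials of the identity map, and a single chain rule
    covers transitions in the source and in the target. *)
Lemma smooth_map_id : @smooth_map R m m M M id.
Proof.
split=> [x|c d ac ad j]; first exact: cvg_id.
by have [+ _] := atlas_compatible ac ad; exact.
Qed.

Lemma transition_mxE c d x : transition_mx c d x = differential_mx id c d x.
Proof. by []. Qed.

End Transition.

Section ChainRule.
Local Open Scope classical_set_scope.
Local Open Scope ring_scope.
Context {R : realType} {m n p : nat}.
Context {M : smooth_manifold R m} {N : smooth_manifold R n} {P : smooth_manifold R p}.

Lemma differential_mx_comp (phi : M -> N) (psi : N -> P)
    (c : chart R M m) (d : chart R N n) (e : chart R P p) x :
  smooth_map phi -> smooth_map psi ->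
  chart_at c x -> chart_at d (phi x) -> chart_at e (psi (phi x)) ->
  differential_mx (psi \o phi) c e x =
    differential_mx phi c d x *m differential_mx psi d e (phi x).
Proof.
move=> sphi spsi cx dx ex; have [ac dcx] := cx; have [ad ddx] := dx.
have dphi := smooth_map_differentiable sphi cx dx.
have dpsi := smooth_map_differentiable spsi dx ex.
rewrite /differential_mx.
have E0 : (d \o phi \o chart_inv c) (c x) = d (phi x) by rewrite /= chart_mapK.
rewrite -E0 in dpsi; have dcomp := differentiable_comp dphi dpsi.
rewrite -[in RHS]E0 -(jacobian_comp dphi dpsi).
(* The two local expressions are only known to coincide where [phi] stays in the domain of [d],
   which holds near [c x]. *)
apply/esym/jacobian_near => //.
have oo := @overlap_open _ _ _ _ _ phi c d sphi.1.
have := open_nbhs_nbhs (conj oo (overlap_chart dcx ddx)).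
apply: filterS => u /chart_image_invP[cu du cK] /=.
by rewrite chart_mapK.
Qed.

End ChainRule.

Section TransitionFacts.
Local Open Scope classical_set_scope.
Local Open Scope ring_scope.
Context {R : realType}.

Lemma transition_mxV m (M : smooth_manifold R m) (c d : chart R M m) x :
  chart_at c x -> chart_at d x ->
  transition_mx c d x *m transition_mx d c x = 1%:M.
Proof.
move=> cx dx; rewrite !transition_mxE.
rewrite -(@differential_mx_comp _ _ _ _ M M M id id c d c)//; try exact: smooth_map_id.
rewrite /differential_mx; have [ac dcx] := cx.
rewrite -[RHS](jacobian_id (c x)); apply/esym/jacobian_near => //.
have nT : nbhs x setT by exact: filterT.
by apply: filterS (near_chart dcx nT) => u [].
Qed.

Lemma transition_mx_unit m (M : smooth_manifold R m) (c d : chart R M m) x :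
  chart_at c x -> chart_at d x -> transition_mx c d x \in unitmx.
Proof.
move=> cx dx.
have mulV (A B : 'M[R]_m) : A *m B = 1%:M -> A \in unitmx by case/mulmx1_unit.
exact: mulV (transition_mxV cx dx).
Qed.

Lemma differential_mx_transition_l m n (M : smooth_manifold R m)
    (N : smooth_manifold R n) (phi : M -> N) c c' d x : smooth_map phi ->
  chart_at c x -> chart_at c' x -> chart_at d (phi x) ->
  differential_mx phi c d x = transition_mx c c' x *m differential_mx phi c' d x.
Proof.
move=> sphi cx c'x dx; rewrite transition_mxE -(differential_mx_comp (phi := id))//.
exact: smooth_map_id.
Qed.

Lemma differential_mx_transition_r m n (M : smooth_manifold R m)
    (N : smooth_manifold R n) (phi : M -> N) c d d' x : smooth_map phi ->
  chart_at c x -> chart_at d (phi x) -> chart_at d' (phi x) ->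
  differential_mx phi c d' x =
    differential_mx phi c d x *m transition_mx d d' (phi x).
Proof.
move=> sphi cx dx d'x; rewrite transition_mxE -(differential_mx_comp (psi := id))//.
exact: smooth_map_id.
Qed.

End TransitionFacts.

(** * Hessians *)

Section LinearAlgebra.
Local Open Scope ring_scope.
Context {R : realType}.

Lemma mxtrace_mul_entry p (A B : 'M[R]_p) : \tr (A *m B^T) = \sum_i \sum_j A i j * B i j.
Proof.
rewrite /mxtrace; apply: eq_bigr => i _; rewrite mxE; apply: eq_bigr => j _.
by rewrite mxE.
Qed.

Lemma mxtraceN p (A : 'M[R]_p) : \tr (- A) = - \tr A.
Proof. exact: raddfN. Qed.

(** Transposition and cyclicity turn the trace into its own opposite. *)
Lemma mxtrace_skew_sym p (A S : 'M[R]_p) : A^T = - A -> S^T = S -> \tr (A *m S) = 0.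
Proof.
move=> At St; have : \tr (A *m S) = - \tr (A *m S).
  by rewrite -{1}mxtrace_tr trmx_mul At St mulmxN mxtraceN mxtrace_mulC.
by move/eqP; rewrite -addr_eq0 -mulr2n mulrn_eq0/= => /eqP.
Qed.

(** Conjugation by [J] preserves traces, fixes [P] and changes the sign of [H]. In the proof, the
    identity is replaced by [- (J *m J)] and one factor travels around the trace. *)
Lemma mxtrace_anticomm p (J P H : 'M[R]_p) : J *m J = - 1%:M -> comm_mx P J ->
  H *m J = - (J *m H) -> \tr (P *m H) = 0.
Proof.
move=> JJ PJ HJ; have : \tr (P *m H) = - \tr (P *m H).
  rewrite -{1}[P]mulmx1 -[1%:M]opprK -JJ mulmxN mulNmx mxtraceN; congr (- _).
  rewrite mulmxA PJ -!mulmxA mxtrace_mulC -!mulmxA HJ !mulmxN.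
  by rewrite [J *m (J *m H)]mulmxA JJ mulNmx mul1mx mulmxN opprK.
by move/eqP; rewrite -addr_eq0 -mulr2n mulrn_eq0/= => /eqP.
Qed.

End LinearAlgebra.

(* Comparing two of these terms by unfolding them does not terminate in practice. *)
#[local] Opaque partial christoffel.

Section Hessian.
Local Open Scope classical_set_scope.
Local Open Scope ring_scope.
Context {R : realType} {m : nat} {M : smooth_manifold R m}.
Variable g : riemannian_metric M.
Implicit Types (c : chart R M m) (x : M) (u v : M -> R).

(** The components of nabla du. Iterating [partial], instead of [cderiv] as in [laplacian], makes
    the calculus rules directly applicable; both give the same value because [chart_inv c] inverts
    [c] near [c x]. *)
Definition hessian c u x : 'M[R]_m := \matrix_(i, j)
  (partial i (partial j (u \o chart_inv c)) (c x)
   - \sum_k christoffel g c x i j k * cderiv c k u x).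

Lemma hessianE c u x i j : hessian c u x i j =
  partial i (partial j (u \o chart_inv c)) (c x)
  - \sum_k christoffel g c x i j k * cderiv c k u x.
Proof. by rewrite /hessian mxE. Qed.

#[local] Opaque hessian.

(** The components of [phi] in a chart are meaningful only near [x], so regularity is asked on a
    coordinate neighbourhood. *)
Definition C2_at c u x := exists U : set 'rV[R]_m,
  [/\ open U, U (c x) & is_Ck 2 U (u \o chart_inv c)].

Lemma cometric_sym c x : chart_at c x -> (cometric g c x)^T = cometric g c x.
Proof. by move=> cx; rewrite /cometric trmx_inv (Defs.metric_sym g cx). Qed.

(** The form as a trace gives access to cyclicity and to the symmetry arguments above. *)
Lemma laplacianE c u x : chart_at c x ->
  laplacian g c u x = \tr (cometric g c x *m (hessian c u x)^T).
Proof.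
move=> [ac cx]; rewrite mxtrace_mul_entry.
have E i j : cderiv c i (cderiv c j u) x = partial i (partial j (u \o chart_inv c)) (c x).
  apply: partial_near; have nT : nbhs x setT by exact: filterT.
  by apply: filterS (near_chart cx nT) => p [_ _ cK] /=; rewrite /cderiv cK.
apply: eq_bigr => i _; apply: eq_bigr => j _; congr (_ * _).
by rewrite E hessianE.
Qed.

(** Schwarz handles the second derivatives, absence of torsion the Christoffel terms. *)
Lemma hessian_sym c u x : chart_at c x -> C2_at c u x ->
  (hessian c u x)^T = hessian c u x.
Proof.
move=> cx [U [oU Ux Cu]]; apply/matrixP => i j; rewrite [LHS]mxE !hessianE.
rewrite (partialC i j oU Ux Cu); congr (_ - _).
by apply: eq_bigr => k _; rewrite christoffel_torsion_free.
Qed.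

Lemma hessianD c u v x : C2_at c u x -> C2_at c v x ->
  hessian c (fun y => u y + v y) x = hessian c u x + hessian c v x.
Proof.
move=> [U [oU Ux Cu]] [V [oV Vx Cv]].
have [du pu] := Cu; have [dv pv] := Cv.
have oUV := openI oU oV.
apply/matrixP => i j; rewrite [RHS]mxE !hessianE.
have -> : partial i (partial j ((fun y => u y + v y) \o chart_inv c)) (c x) =
    partial i (fun p => partial j (u \o chart_inv c) p
                      + partial j (v \o chart_inv c) p) (c x).
  apply: partial_near; apply: (@open_near_eq _ _ _ _ _ (U `&` V)) => // p [Up Vp].
  by apply: partialD; [exact: du|exact: dv].
have -> := partialD i ((pu j).1 _ Ux) ((pv j).1 _ Vx).
under eq_bigr => k _.
  have -> : cderiv c k (fun y => u y + v y) x = cderiv c k u x + cderiv c k v x.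
    by apply: partialD; [exact: du|exact: dv].
  rewrite mulrDr; over.
by rewrite big_split opprD addrACA.
Qed.

Lemma hessianN c u x : C2_at c u x ->
  hessian c (fun y => - u y) x = - hessian c u x.
Proof.
move=> [U [oU Ux Cu]]; have [du pu] := Cu.
apply/matrixP => i j; rewrite [RHS]mxE !hessianE.
have -> : partial i (partial j ((fun y => - u y) \o chart_inv c)) (c x) =
    partial i (fun p => - partial j (u \o chart_inv c) p) (c x).
  apply: partial_near; apply: (@open_near_eq _ _ _ _ _ U) => // p Up.
  by apply: partialN; exact: du.
have -> := partialN i ((pu j).1 _ Ux).
under eq_bigr => k _.
  have -> : cderiv c k (fun y => - u y) x = - cderiv c k u x.
    by apply: partialN; exact: du.
  rewrite mulrN; over.
by rewrite sumrN opprB opprK addrC.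
Qed.

Definition cgradient c u x : 'cV[R]_m := \col_i cderiv c i u x.

(** Besides the terms linear in the Hessians there is the symmetrized product of the gradients; its
    trace later exposes the entries of [gram]. *)
Lemma hessianM c u v x : chart_at c x -> C2_at c u x -> C2_at c v x ->
  hessian c (fun y => u y * v y) x =
    v x *: hessian c u x + u x *: hessian c v x +
    (cgradient c u x *m (cgradient c v x)^T + cgradient c v x *m (cgradient c u x)^T).
Proof.
move=> cx [U [oU Ux Cu]] [V [oV Vx Cv]].
have [du pu] := Cu; have [dv pv] := Cv; have [ac dcx] := cx.
have oUV := openI oU oV.
have grad a b : (cgradient c a x *m (cgradient c b x)^T) =
    \matrix_(i, j) (cderiv c i a x * cderiv c j b x).
  by apply/matrixP => i j; rewrite /cgradient [LHS]mxE big_ord1 !mxE.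
apply/matrixP => i j; rewrite !grad.
rewrite [RHS]mxE [X in _ = X + _]mxE [X in _ = _ + X]mxE.
rewrite [X in _ = X + _ + _]mxE [X in _ = _ + X + _]mxE.
rewrite [X in _ = _ + (X + _)]mxE [X in _ = _ + (_ + X)]mxE !hessianE.
have -> : partial i (partial j ((fun y => u y * v y) \o chart_inv c)) (c x) =
    partial i (fun p => partial j (u \o chart_inv c) p * (v \o chart_inv c) p
      + (u \o chart_inv c) p * partial j (v \o chart_inv c) p) (c x).
  apply: partial_near; apply: (@open_near_eq _ _ _ _ _ (U `&` V)) => // p [Up Vp].
  by apply: partialM; [exact: du|exact: dv].
have dju := (pu j).1 _ Ux; have djv := (pv j).1 _ Vx.
have duv1 := differentiableM dju (dv _ Vx); have duv2 := differentiableM (du _ Ux) djv.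
have -> := partialD i duv1 duv2.
have -> := partialM i dju (dv _ Vx); have -> := partialM i (du _ Ux) djv.
under eq_bigr => k _.
  have -> : cderiv c k (fun y => u y * v y) x =
      cderiv c k u x * v x + u x * cderiv c k v x.
    by have := partialM k (du _ Ux) (dv _ Vx); rewrite /= (chart_mapK dcx).
  rewrite mulrDr mulrA [_ * (u x * _)]mulrCA; over.
rewrite big_split /=.
rewrite -mulr_suml -mulr_sumr.
rewrite /= (chart_mapK dcx).
have alg (a b s t p q r w ux vx : R) : a * vx + p * q + (r * w + ux * b) -
    (s * vx + ux * t) = vx * (a - s) + ux * (b - t) + (r * w + q * p) by ring.
exact: alg.
Qed.

End Hessian.

Section HessianOfComposite.
Local Open Scope classical_set_scope.
Local Open Scope ring_scope.
Context {R : realType} {m n : nat}.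
Context {M : smooth_manifold R m} {N : smooth_manifold R n}.
Variables (g : riemannian_metric M) (phi : M -> N).
Hypothesis sphi : smooth_map phi.
Implicit Types (c : chart R M m) (d : chart R N n) (x : M).

Lemma near_overlap c d x : chart_at c x -> chart_at d (phi x) ->
  \forall q \near c x, overlap phi c d q.
Proof.
move=> [ac cx] [ad dx]; apply: open_nbhs_nbhs; split.
  by apply: overlap_open; have [] := sphi.
exact: overlap_chart.
Qed.

Lemma component_C2_at c d x a : chart_at c x -> chart_at d (phi x) ->
  C2_at c (fun y => d (phi y) 0 a) x.
Proof.
move=> [ac cx] [ad dx]; have [cphi Sphi] := sphi; exists (overlap phi c d).
split; first exact: overlap_open.
  exact: overlap_chart.
exact: (Sphi c d ac ad a 2).
Qed.

Definition coord_hessian (f : 'rV[R]_n -> R) v : 'M[R]_n :=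
  \matrix_(b, a) partial b (partial a f) v.

(** No connection on [N] enters: [f] is differentiated in the flat coordinates of [d]. The
    Christoffel symbols of [M] meet first derivatives only and regroup into the Hessians of the
    components of [phi]. *)
Lemma hessian_comp c d x (f : N -> R) (V : set 'rV[R]_n) :
  chart_at c x -> chart_at d (phi x) -> open V -> V (d (phi x)) ->
  is_Ck 2 V (f \o chart_inv d) ->
  hessian g c (f \o phi) x =
    differential_mx phi c d x *m coord_hessian (f \o chart_inv d) (d (phi x))
      *m (differential_mx phi c d x)^T
    + \sum_a cderiv d a f (phi x) *: hessian g c (fun y => d (phi y) 0 a) x.
Proof.
move=> cx dx oV Vx Cf; have [ac dcx] := cx; have [ad ddx] := dx.
set D := differential_mx phi c d x.
pose fd := f \o chart_inv d; pose psi := d \o phi \o chart_inv c; pose p := c x.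
pose psi_ a q := psi q 0 a.
have [df pf] := Cf; rewrite -/fd in df pf.
have psip : psi p = d (phi x) by rewrite /psi /p /= chart_mapK.
have DE i a : D i a = partial i (psi_ a) p by exact: differential_mx_entry.
have dpsi q : overlap phi c d q -> differentiable psi q.
  exact: local_map_differentiable.
have op : overlap phi c d p by exact: overlap_chart.
have n0 : \forall q \near p, overlap phi c d q /\ V (psi q).
  have n1 : nbhs (psi p) V by rewrite psip; exact: open_nbhs_nbhs.
  have cpsi : psi @ p --> psi p by exact: differentiable_continuous (dpsi p op).
  by apply: filterS2 (near_overlap cx dx) (cpsi _ n1) => q; split.
(* The first-order chain rule is needed on a whole neighbourhood, because it is differentiated once
   more below. *)
have n1 j : \forall q \near p, partial j ((f \o phi) \o chart_inv c) q =
    \sum_a partial a fd (psi q) * partial j (psi_ a) q.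
  apply: filterS2 n0 (near_join n0) => q [oq Vq] nq.
  rewrite -(partial_comp j (dpsi q oq) (df _ Vq)); apply: partial_near.
  apply: filterS nq => r [/chart_image_invP[cr dr _] _].
  by rewrite /= /fd /psi /= chart_mapK.
have gradE k : cderiv c k (f \o phi) x =
    \sum_a partial a fd (d (phi x)) * partial k (psi_ a) p.
  by rewrite -psip; exact: nbhs_singleton (n1 k).
have dpf a : differentiable (partial a fd) (psi p).
  by rewrite psip; exact: (pf a).1.
have dpsi2 j a : differentiable (partial j (psi_ a)) p.
  have [_ Sphi] := sphi; have [_ C1] := Sphi c d ac ad a 2.
  exact: (C1 j).1.
have dcomp a : differentiable (partial a fd \o psi) p.
  exact: differentiable_comp (dpsi p op) (dpf a).
have hessE i j : partial i (partial j ((f \o phi) \o chart_inv c)) p =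
    \sum_a ((\sum_b partial b (partial a fd) (d (phi x)) * partial i (psi_ b) p)
              * partial j (psi_ a) p
            + partial a fd (d (phi x)) * partial i (partial j (psi_ a)) p).
  rewrite (partial_near i (n1 j)).
  rewrite (@partial_sum _ _ _ _ i (fun a q => (partial a fd \o psi) q * partial j (psi_ a) q)).
    apply: eq_bigr => a _; rewrite (partialM i (dcomp a) (dpsi2 j a)).
    by rewrite (partial_comp i (dpsi p op) (dpf a)) /= psip.
  by move=> a; exact: differentiableM (dcomp a) (dpsi2 j a).
apply/matrixP => i j.
rewrite hessianE hessE [RHS]mxE summxE.
have -> : (D *m coord_hessian fd (d (phi x)) *m D^T) i j =
    \sum_a (\sum_b partial b (partial a fd) (d (phi x)) * partial i (psi_ b) p)
              * partial j (psi_ a) p.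
  rewrite mxE; apply: eq_bigr => a _; rewrite [_^T _ _]mxE DE; congr (_ * _).
  by rewrite mxE; apply: eq_bigr => b _; rewrite DE [coord_hessian _ _ _ _]mxE mulrC.
rewrite big_split/= -addrA; congr (_ + _).
under [X in _ = X]eq_bigr => a _ do rewrite mxE hessianE mulrBr.
rewrite sumrB; congr (_ - _).
under eq_bigr => k _ do rewrite gradE mulr_sumr.
rewrite exchange_big; apply: eq_bigr => a _; rewrite mulr_sumr.
by apply: eq_bigr => k _; rewrite mulrCA.
Qed.

End HessianOfComposite.

(** * Laplacian and divergence *)

Section Divergence.
Local Open Scope classical_set_scope.
Local Open Scope ring_scope.
Context {R : realType} {m n : nat}.
Context {M : smooth_manifold R m} {N : smooth_manifold R n}.
Variables (g : riemannian_metric M) (phi : M -> N).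
Hypothesis sphi : smooth_map phi.
Implicit Types (c : chart R M m) (d : chart R N n) (x : M).

Definition gram c d x : 'M[R]_n :=
  (differential_mx phi c d x)^T *m cometric g c x *m differential_mx phi c d x.

(* The coordinates in d of trace (nabla dphi), for the flat connection of d on N. *)
Definition tension c d x : 'rV[R]_n :=
  \row_a laplacian g c (fun y => d (phi y) 0 a) x.

Lemma laplacian_comp c d x (f : N -> R) (V : set 'rV[R]_n) :
  chart_at c x -> chart_at d (phi x) -> open V -> V (d (phi x)) ->
  is_Ck 2 V (f \o chart_inv d) ->
  laplacian g c (f \o phi) x =
    \tr (gram c d x *m (coord_hessian (f \o chart_inv d) (d (phi x)))^T)
    + \sum_a cderiv d a f (phi x) * tension c d x 0 a.
Proof.
move=> cx dx oV Vx Cf; rewrite (laplacianE _ _ cx).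
rewrite (hessian_comp g sphi cx dx oV Vx Cf) linearD /= mulmxDr mxtraceD; congr (_ + _).
  (* Cyclicity brings the trailing transposed differential to the front, which assembles [gram]. *)
  by rewrite !trmx_mul trmxK !mulmxA mxtrace_mulC /gram !mulmxA.
rewrite linear_sum /= mulmx_sumr linear_sum /=; apply: eq_bigr => a _.
by rewrite linearZ /= -scalemxAr linearZ /= /tension mxE (laplacianE _ _ cx).
Qed.

(** This differentiates [F D = D J] in direction [i], where [J] is a constant matrix and contributes
    no derivative. [H] holds the components in direction [i] of nabla dphi for the flat connection
    of [d]; the Christoffel terms on both sides match by the undifferentiated relation at [x]. *)
Lemma nabla_endo_differential (F : endo_field M) c d x i (J : 'M[R]_n) :
  chart_at c x -> chart_at d (phi x) ->
  (\forall q \near c x,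
    F c (chart_inv c q) *m differential_mx phi c d (chart_inv c q) =
    differential_mx phi c d (chart_inv c q) *m J) ->
  let H := \matrix_(j, a) hessian g c (fun y => d (phi y) 0 a) x i j in
  nabla_endo g F c x i *m differential_mx phi c d x = H *m J - F c x *m H.
Proof.
move=> cx dx FD H; have [ac dcx] := cx; have [ad ddx] := dx.
pose psi_ a q := d (phi (chart_inv c q)) 0 a; pose p := c x.
pose D q := differential_mx phi c d (chart_inv c q).
have Dp : differential_mx phi c d x = D p by rewrite /D /p chart_mapK.
have DE k a : D p k a = partial k (psi_ a) p.
  by rewrite -Dp; exact: differential_mx_entry.
pose Gam : 'M[R]_m := \matrix_(j, l) christoffel g c x i j l.
pose dF : 'M[R]_m := \matrix_(j, k) partial i (fun q => F c (chart_inv c q) j k) p.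
pose DD : 'M[R]_(m, n) := \matrix_(j, a) partial i (partial j (psi_ a)) p.
have nablaE : nabla_endo g F c x i = dF + F c x *m Gam - Gam *m F c x.
  apply/matrixP => j k; rewrite /nabla_endo mxE [RHS]mxE [X in _ = X + _]mxE.
  rewrite [X in _ = _ + X]mxE [X in _ = X + _ - _]mxE; congr (_ + _ - _).
    by rewrite mxE; apply: eq_bigr => l _; rewrite [Gam _ _]mxE.
  by rewrite mxE; apply: eq_bigr => l _; rewrite [Gam _ _]mxE.
have HE : H = DD - Gam *m D p.
  apply/matrixP => j a; rewrite mxE hessianE [RHS]mxE [X in _ = X + _]mxE.
  rewrite [X in _ = _ + X]mxE; congr (_ - _).
  rewrite mxE; apply: eq_bigr => k _; rewrite [Gam _ _]mxE DE; congr (_ * _).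
have dFq j k : differentiable (fun q => F c (chart_inv c q) j k) p.
  apply: (is_Ck_differentiable (endo_smooth F ac j k 1)).
  by exists x.
have op : overlap phi c d p by exact: overlap_chart.
have dDq k a : differentiable (fun q => D q k a) p.
  exact: (is_Ck_differentiable (smooth_differential_mx sphi ac ad k a 1) op).
have dDE j a : partial i (fun q => D q j a) p = DD j a.
  rewrite mxE; apply: partial_near.
  apply: filterS (near_overlap sphi cx dx) => q /chart_image_invP[cq dq qK].
  by rewrite /D (differential_mx_entry j a sphi (conj ac cq) (conj ad dq)) /cderiv qK.
(* The plain product rule; the Christoffel terms enter only in the final rearrangement. *)
have key : dF *m D p + F c x *m DD = DD *m J.
  apply/matrixP => j a; rewrite mxE [X in X + _]mxE [X in _ + X]mxE [RHS]mxE.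
  have E : partial i (fun q => \sum_k F c (chart_inv c q) j k * D q k a) p =
           partial i (fun q => \sum_b D q j b * J b a) p.
    apply: partial_near; apply: filterS FD => q /matrixP/(_ j a).
    by rewrite [LHS]mxE [RHS]mxE.
  move: E.
  rewrite (@partial_sum _ _ _ _ i (fun k q => F c (chart_inv c q) j k * D q k a)); last first.
    by move=> k; exact: differentiableM (dFq j k) (dDq k a).
  rewrite (@partial_sum _ _ _ _ i (fun b q => D q j b * J b a)); last first.
    by move=> b; exact: differentiableM (dDq j b) (differentiable_cst _ _).
  under eq_bigr => k _ do rewrite (partialM i (dFq j k) (dDq k a)) dDE.
  under [in RHS]eq_bigr => b _ do
    rewrite (partialM i (dDq j b) (differentiable_cst _ _)) dDE partial_cst mulr0 addr0.
  move=> <-; rewrite big_split/=; congr (_ + _).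
    by apply: eq_bigr => k _; rewrite [dF _ _]mxE.
  by apply: eq_bigr => k _; rewrite /p chart_mapK.
have FDp : F c x *m D p = D p *m J.
  by rewrite -Dp; have := nbhs_singleton FD; rewrite (chart_mapK dcx).
rewrite nablaE HE Dp mulmxBl mulmxDl -[Gam *m F c x *m _]mulmxA FDp.
rewrite mulmxBl mulmxBr -key !mulmxA.
by rewrite opprB [X in _ = _ + X]addrC addrA [X in _ = X + _]addrAC addrK addrAC.
Qed.

Lemma divergence_differential (F : endo_field M) c d x (J : 'M[R]_n) :
  chart_at c x -> chart_at d (phi x) ->
  (\forall q \near c x,
    F c (chart_inv c q) *m differential_mx phi c d (chart_inv c q) =
    differential_mx phi c d (chart_inv c q) *m J) ->
  (cometric g c x *m F c x)^T = - (cometric g c x *m F c x) ->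
  divergence g F c x *m differential_mx phi c d x = tension c d x *m J.
Proof.
move=> cx dx FD skew; apply/rowP => a.
pose h b := hessian g c (fun y => d (phi y) 0 b) x.
have E i := nabla_endo_differential i cx dx FD.
have -> : (divergence g F c x *m differential_mx phi c d x) 0 a =
    \sum_i \sum_j cometric g c x i j *
      (\sum_b h b i j * J b a - \sum_k F c x j k * h a i k).
  rewrite /divergence mulmx_suml summxE; apply: eq_bigr => i _.
  rewrite mulmx_suml summxE; apply: eq_bigr => j _.
  rewrite -scalemxAl -row_mul E mxE; congr (_ * _).
  rewrite mxE [LHS]mxE [X in X + _]mxE [X in _ + X]mxE.
  congr (_ - _); first by apply: eq_bigr => b _; rewrite mxE.
  by rewrite mxE; apply: eq_bigr => k _; rewrite [X in _ * X]mxE.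
under eq_bigr => i _ do under eq_bigr => j _ do rewrite mulrBr.
under eq_bigr => i _ do rewrite sumrB.
rewrite sumrB.
(* The contribution of [F c x *m H], written as a trace in order to use the skewness hypothesis. *)
have -> : \sum_i \sum_j cometric g c x i j * (\sum_k F c x j k * h a i k) = 0.
  transitivity (\tr (cometric g c x *m F c x *m (h a)^T)).
    rewrite mxtrace_mul_entry; apply: eq_bigr => i _.
    under eq_bigr => j _ do rewrite mulr_sumr.
    rewrite exchange_big; apply: eq_bigr => k _; rewrite [(_ *m _) _ _]mxE mulr_suml.
    by apply: eq_bigr => j _; rewrite mulrA.
  have hs := hessian_sym g cx (component_C2_at sphi a cx dx).
  by rewrite hs; exact: mxtrace_skew_sym.
rewrite subr0 [RHS]mxE.
under eq_bigr => i _ do under eq_bigr => j _ do rewrite mulr_sumr.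
under eq_bigr => i _ do rewrite exchange_big.
rewrite exchange_big; apply: eq_bigr => b _ /=.
rewrite /tension mxE (laplacianE _ _ cx) mxtrace_mul_entry mulr_suml.
apply: eq_bigr => i _; rewrite mulr_suml; apply: eq_bigr => j _.
by rewrite mulrA.
Qed.

End Divergence.

(** * The induced f-structure *)

Section BilinearForms.
Local Open Scope ring_scope.
Context {R : realType}.

Lemma bilinear_mx_inj p q (S T : 'M[R]_(p, q)) :
  (forall (X : 'rV_p) (Y : 'rV_q), (X *m S *m Y^T) 0 0 = (X *m T *m Y^T) 0 0) -> S = T.
Proof.
move=> ST; apply/matrixP => i j; have := ST (delta_mx 0 i) (delta_mx 0 j).
by rewrite !trmx_delta -!rowE -!colE !mxE.
Qed.

(** For [v] in the kernel, [w = v D^T g^-1] satisfies [w g w^T = 0] and vanishes by positivity. Then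
    [v D^T = 0], and the rank hypothesis on [D] gives [v = 0]. *)
Lemma posdef_pullback_unit p q (g : 'M[R]_p) (D : 'M[R]_(p, q)) :
  (forall X : 'rV_p, X != 0 -> 0 < (X *m g *m X^T) 0 0) -> g \in unitmx ->
  g^T = g -> row_full D -> D^T *m invmx g *m D \in unitmx.
Proof.
move=> gpos gU gT fullD; rewrite -row_free_unit -kermx_eq0.
apply/rowV0P => v /sub_kermxP vP0.
have w0 : v *m D^T *m invmx g = 0.
  apply/eqP; apply/negPn/negP => /gpos.
  rewrite mulmxKV // !trmx_mul trmxK trmx_inv gT !mulmxA.
  by move: vP0 => /(congr1 (mulmx^~ v^T)); rewrite mul0mx !mulmxA => ->; rewrite mxE ltxx.
have DTfree : row_free D^T by rewrite /row_free mxrank_tr.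
apply: (row_free_inj DTfree); rewrite mul0mx.
by rewrite -[LHS](mulmxKV gU) w0 mul0mx.
Qed.

Lemma invmxM p (A B : 'M[R]_p) : A \in unitmx -> B \in unitmx ->
  invmx (A *m B) = invmx B *m invmx A.
Proof.
move=> AU BU; have ABU : A *m B \in unitmx by rewrite unitmx_mul AU.
apply: (can_inj (mulKmx ABU)); rewrite mulmxV // mulmxA.
by rewrite (mulmxK BU) mulmxV.
Qed.

End BilinearForms.

Section StandardComplexStructure.
Local Open Scope ring_scope.
Context {R : realType} {n : nat}.

Lemma standard_J_sqr : standard_J R n *m standard_J R n = - 1%:M.
Proof.
rewrite /standard_J mulmx_block !(mul0mx, mulmx0, mul1mx, mulmx1) !(add0r, addr0).
by rewrite scalar_mx_block opp_block_mx !oppr0.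
Qed.

Lemma standard_J_tr : (standard_J R n)^T = - standard_J R n.
Proof.
by rewrite /standard_J tr_block_mx opp_block_mx !trmx0 linearN /= !trmx1 !oppr0 opprK.
Qed.

Lemma mul_standard_J (X : 'rV[R]_(n + n)) :
  (forall a, (X *m standard_J R n) 0 (lshift n a) = - X 0 (rshift n a)) /\
  (forall a, (X *m standard_J R n) 0 (rshift n a) = X 0 (lshift n a)).
Proof.
rewrite -[X]hsubmxK /standard_J mul_row_block !(mulmx0, mulmx1, mulmxN) add0r addr0.
by split=> a; rewrite ?row_mxEl ?row_mxEr // mxE.
Qed.

End StandardComplexStructure.

(** * PHWC in terms of the Gram matrix, and the explicit field F *)

Section PullbackFStructure.
Local Open Scope classical_set_scope.
Local Open Scope ring_scope.
Context {R : realType} {m n : nat}.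
Context {M : smooth_manifold R m} {N : smooth_manifold R (n + n)}.
Variables (g : riemannian_metric M) (J : complex_structure N).
Variables (h : riemannian_metric N) (hJ : hermitian_metric J h) (phi : M -> N).
Hypothesis sub : submersion phi.
Implicit Types (c : chart R M m) (d : chart R N (n + n)) (x : M).

Let sphi : smooth_map phi. Proof. by have [] := sub. Qed.

Lemma gram_sym c d x : chart_at c x -> (gram g phi c d x)^T = gram g phi c d x.
Proof. by move=> cx; rewrite /gram !trmx_mul trmxK (cometric_sym g cx) mulmxA. Qed.

Lemma gram_unit c d x : chart_at c x -> chart_at d (phi x) ->
  gram g phi c d x \in unitmx.
Proof.
move=> cx dx; apply: posdef_pullback_unit.
- exact: metric_pos cx.
- exact: metric_unit.
- exact: Defs.metric_sym cx.
- by have [_ full] := sub; exact: full.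
Qed.

Lemma gram_transition c d d' x : chart_at c x -> chart_at d (phi x) ->
  chart_at d' (phi x) -> let T := transition_mx d d' (phi x) in
  gram g phi c d' x = T^T *m gram g phi c d x *m T.
Proof.
move=> cx dx d'x T; rewrite /gram (differential_mx_transition_r sphi cx dx d'x) -/T.
by rewrite trmx_mul !mulmxA.
Qed.

(** With [J T = T J'] and [P' = T^T P T], both summands undergo the same congruence by [T]. *)
Lemma gram_invariant c d d' x : chart_at c x -> chart_at d (phi x) ->
  chart_at d' (phi x) ->
  gram g phi c d x *m J d (phi x) + (J d (phi x))^T *m gram g phi c d x = 0 ->
  gram g phi c d' x *m J d' (phi x) + (J d' (phi x))^T *m gram g phi c d' x = 0.
Proof.
move=> cx dx d'x; rewrite (gram_transition cx dx d'x).
have JT := endo_transition J dx d'x.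
set T := transition_mx d d' (phi x) in JT *; set P := gram g phi c d x => PJ.
have -> : T^T *m P *m T *m J d' (phi x) + (J d' (phi x))^T *m (T^T *m P *m T) =
    T^T *m (P *m J d (phi x) + (J d (phi x))^T *m P) *m T.
  have -> : (J d' (phi x))^T *m (T^T *m P *m T) = T^T *m (J d (phi x))^T *m P *m T.
    by rewrite !mulmxA -trmx_mul -JT trmx_mul.
  by rewrite -[_ *m T *m _]mulmxA -JT mulmxDr mulmxDl !mulmxA.
by rewrite PJ mulmx0 mul0mx.
Qed.

Lemma hermitian_mx d y : chart_at d y -> J d y *m h d y = - (h d y *m (J d y)^T).
Proof.
move=> dy; have JJ := complex_endo_sqr J dy.
have E : J d y *m h d y *m (J d y)^T = h d y.
  apply: bilinear_mx_inj => X Y; have := hJ dy X Y.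
  by rewrite /pairing trmx_mul !mulmxA.
rewrite -{2}E -mulmxA -trmx_mul JJ linearN /= trmx1 mulmxN mulmx1 opprK //.
Qed.

(** The adjoint is forced to be [h D^T g^-1], which makes the operator [h P]. Since [J h = - h J^T]
    and [h] is invertible, [h] cancels from the commutation relation. *)
Lemma PHWC_at c d x : chart_at c x -> chart_at d (phi x) ->
  (exists2 A, is_adjoint g h phi c d x A &
     comm_mx (A *m differential_mx phi c d x) (J d (phi x))) <->
  gram g phi c d x *m J d (phi x) + (J d (phi x))^T *m gram g phi c d x = 0.
Proof.
move=> cx dx; set D := differential_mx phi c d x; set P := gram g phi c d x.
set H := h d (phi x); set G := cometric g c x; set K := J d (phi x).
have gU := metric_unit g cx; have HU : H \in unitmx := metric_unit h dx.
have HT : H^T = H := Defs.metric_sym h dx.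
have GT : G^T = G := cometric_sym g cx.
have KH : K *m H = - (H *m K^T) := hermitian_mx dx.
have ADP (A : 'M[R]_(n + n, m)) : A = H *m D^T *m G -> A *m D = H *m P.
  by move=> ->; rewrite /P /gram -/D -/G !mulmxA.
have comm A : A *m D = H *m P ->
    comm_mx (A *m D) K <-> P *m K + K^T *m P = 0.
  move=> ->; rewrite /comm_mx; split=> E.
    apply: (can_inj (mulKmx HU)).
    rewrite mulmx0 mulmxDr [H *m (P *m K)]mulmxA E [K *m (H *m P)]mulmxA KH.
    by rewrite [H *m (K^T *m P)]mulmxA mulNmx addrC subrr.
  rewrite [K *m (H *m P)]mulmxA KH mulNmx -[H *m P *m K]mulmxA.
  rewrite -[H *m K^T *m P]mulmxA -mulmxN; congr (_ *m _).
  by apply/eqP; rewrite -addr_eq0 E.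
split=> [[A adjA cA]|E].
  apply: (comm A (ADP A _)).1 cA.
  have : g c x *m A^T = D *m H.
    apply: bilinear_mx_inj => X E; have := adjA X E.
    by rewrite /pairing trmx_mul !mulmxA.
  move/(congr1 (mulmx G)); rewrite (mulKmx gU) => /(congr1 trmx).
  by rewrite trmxK !trmx_mul HT GT.
exists (H *m D^T *m G); last exact: (comm _ (ADP _ erefl)).2 E.
move=> X E1; rewrite /pairing -/D -/H !trmx_mul trmxK HT GT /G /cometric !mulmxA.
by rewrite mulmxK.
Qed.

(* Y |-> Y *m invmx (gram c d x) *m D^T *m cometric c x is the horizontal lift
   (dphi|_H)^-1. *)
Definition f_matrix c d x : 'M[R]_m :=
  differential_mx phi c d x *m J d (phi x) *m invmx (gram g phi c d x) *m
    (differential_mx phi c d x)^T *m cometric g c x.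

(** The transition matrix cancels between consecutive factors. This independence is what allows the
    chart of [N] to be chosen point by point in [f_field]. *)
Lemma f_matrix_target c d d' x : chart_at c x -> chart_at d (phi x) ->
  chart_at d' (phi x) -> f_matrix c d x = f_matrix c d' x.
Proof.
move=> cx dx d'x; rewrite /f_matrix (gram_transition cx dx d'x).
rewrite (differential_mx_transition_r sphi cx dx d'x).
have TU := transition_mx_unit dx d'x; have JT := endo_transition J dx d'x.
set T := transition_mx _ _ _ in TU JT *.
move: (gram_unit cx dx); move: (gram g phi c d x) => P PU.
have TTU : T^T \in unitmx by rewrite unitmx_tr.
have TPU : T^T *m P \in unitmx by rewrite unitmx_mul TTU.
rewrite -[_ *m T *m J d' _]mulmxA -JT trmx_mul !mulmxA.
have -> : invmx (T^T *m P *m T) = invmx T *m invmx P *m invmx T^T.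
  by rewrite !invmxM // mulmxA.
by rewrite !mulmxA (mulmxK TU) (mulmxKV TTU).
Qed.

(** A change of chart in [M] leaves [gram] unchanged; only the outer factors [D] and [D^T g^-1]
    transform. *)
Lemma f_matrix_source c c' d x : chart_at c x -> chart_at c' x ->
  chart_at d (phi x) ->
  f_matrix c d x *m transition_mx c c' x = transition_mx c c' x *m f_matrix c' d x.
Proof.
move=> cx c'x dx; have DE := differential_mx_transition_l sphi cx c'x dx.
have gE := metric_transition g cx c'x; have TU := transition_mx_unit cx c'x.
have gU := metric_unit g c'x.
set T := transition_mx c c' x in DE gE TU *.
have TTU : T^T \in unitmx by rewrite unitmx_tr.
have GE : cometric g c x = invmx T^T *m cometric g c' x *m invmx T.
  by rewrite /cometric gE !invmxM ?unitmx_mul ?TU // mulmxA.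
have TGT : T^T *m cometric g c x *m T = cometric g c' x.
  by rewrite GE !mulmxA (mulmxV TTU) mul1mx (mulmxKV TU).
have PE : gram g phi c d x = gram g phi c' d x.
  by rewrite /gram DE trmx_mul -TGT !mulmxA.
by rewrite /f_matrix PE DE trmx_mul -TGT !mulmxA.
Qed.

Lemma f_matrix_differential c d x : chart_at c x -> chart_at d (phi x) ->
  f_matrix c d x *m differential_mx phi c d x =
  differential_mx phi c d x *m J d (phi x).
Proof.
move=> cx dx; have PU := gram_unit cx dx.
rewrite /f_matrix -!mulmxA; congr (_ *m _).
have -> : (differential_mx phi c d x)^T *m (cometric g c x *m differential_mx phi c d x)
  = gram g phi c d x by rewrite /gram mulmxA.
by rewrite mulVmx // mulmx1.
Qed.

(** For [B = g^-1 D] and symmetric [g^-1], the matrix [g^-1 F] is [B (J P^-1) B^T], a congruence of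
    [J P^-1], which is skew by the hypothesis on [P]. *)
Lemma f_matrix_skew c d x : chart_at c x -> chart_at d (phi x) ->
  gram g phi c d x *m J d (phi x) + (J d (phi x))^T *m gram g phi c d x = 0 ->
  (cometric g c x *m f_matrix c d x)^T = - (cometric g c x *m f_matrix c d x).
Proof.
move=> cx dx; have PU := gram_unit cx dx; have PT := gram_sym d cx.
rewrite /f_matrix; move: (gram g phi c d x) PU PT => P PU PT.
set K := J d (phi x); set D := differential_mx phi c d x => PK.
have GT := cometric_sym g cx.
have KP : invmx P *m K^T = - (K *m invmx P).
  apply: (can_inj (mulKmx PU)); rewrite mulKVmx // mulmxN.
  apply: (can_inj (mulmxK PU)); rewrite mulNmx -!mulmxA mulVmx // mulmx1.
  by apply/eqP; rewrite -addr_eq0 addrC PK.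
rewrite !trmx_mul trmxK GT trmx_inv PT -!mulmxA.
rewrite [invmx P *m (K^T *m _)]mulmxA KP mulNmx !mulmxN.
by rewrite !mulmxA.
Qed.

Lemma smooth_f_matrix c d : atlas c -> atlas d ->
  smooth_mx (overlap phi c d) (fun u => f_matrix c d (chart_inv c u)).
Proof.
move=> ac ad; have [cphi Sphi] := sphi.
have oO := @overlap_open _ _ _ _ _ phi c d cphi.
have sD := smooth_differential_mx sphi ac ad.
have chartO u : overlap phi c d u ->
    chart_at c (chart_inv c u) /\ chart_at d (phi (chart_inv c u)).
  by move=> /chart_image_invP[].
have Odom : overlap phi c d `<=` c @` chart_dom c.
  by move=> _ [x [cx _] <-]; exists x.
have sG : smooth_mx (overlap phi c d) (fun u => cometric g c (chart_inv c u)).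
  apply: smooth_invmx => //.
    by move=> u /chartO[cu _]; exact: metric_unit.
  by move=> i j k; apply: is_Ck_subset Odom _; exact: (metric_smooth g ac).
have sP : smooth_mx (overlap phi c d) (fun u => gram g phi c d (chart_inv c u)).
  by apply: smooth_mxM => //; apply: smooth_mxM => //; exact: smooth_mxT.
(* [J] lives on [N]; its smoothness is transported by the local expression of [phi]. *)
have sJ : smooth_mx (overlap phi c d) (fun u => J d (phi (chart_inv c u))).
  move=> i j k.
  apply: (@is_Ck_eq _ _ _ _ ((fun v => J d (chart_inv d v) i j) \o
             (d \o phi \o chart_inv c))) => //.
    by move=> u /chartO[_ [_ du]] /=; rewrite chart_mapK.
  apply: (@is_Ck_comp _ _ _ _ _ (d @` chart_dom d)) => //.
  - by move=> _ [u /chartO[_ [_ du]] <-]; exists (phi (chart_inv c u)).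
  - by move=> a; exact: Sphi.
  - exact: (endo_smooth J ad).
apply: smooth_mxM => //; apply: smooth_mxM => //; last exact: smooth_mxT.
apply: smooth_mxM => //; first exact: smooth_mxM.
by apply: smooth_invmx => // u /chartO[cu du]; exact: gram_unit.
Qed.

Definition chart_around (y : N) : chart R N (n + n) :=
  projT1 (cid2 (atlas_cover y)).

Lemma chart_aroundP y : chart_at (chart_around y) y.
Proof. by rewrite /chart_around; case: cid2. Qed.

(** The chosen chart of [N] may jump from point to point, but by [f_matrix_target] one fixed chart
    gives the same matrices near each point. *)
Lemma f_field_smooth c : atlas c -> forall i j, is_smooth (c @` chart_dom c)
  (fun u => f_matrix c (chart_around (phi (chart_inv c u))) (chart_inv c u) i j).
Proof.
move=> ac i j k; apply: is_Ck_local => _ [x cx <-].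
pose d := chart_around (phi x); have [ad dx] := chart_aroundP (phi x).
exists (overlap phi c d); first exact: overlap_chart.
apply: is_Ck_eq (smooth_f_matrix ac ad i j k).
  by apply: overlap_open; have [] := sphi.
move=> u /chart_image_invP[cu du _].
by rewrite (@f_matrix_target c d (chart_around (phi (chart_inv c u)))) //; exact: chart_aroundP.
Qed.

Lemma f_field_transition c c' x : chart_at c x -> chart_at c' x ->
  f_matrix c (chart_around (phi x)) x *m transition_mx c c' x =
  transition_mx c c' x *m f_matrix c' (chart_around (phi x)) x.
Proof. by move=> cx c'x; apply: f_matrix_source => //; exact: chart_aroundP. Qed.

Definition f_field : endo_field M :=
  EndoField (endo_mx := fun c x => f_matrix c (chart_around (phi x)) x)
    f_field_smooth f_field_transition.

Lemma f_fieldE c d x : chart_at c x -> chart_at d (phi x) ->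
  f_field c x = f_matrix c d x.
Proof. by move=> cx dx; apply: f_matrix_target => //; exact: chart_aroundP. Qed.

Lemma f_field_induced : induced_f_structure g J phi f_field.
Proof.
move=> c d x cx dx; rewrite (f_fieldE cx dx).
have FD := f_matrix_differential cx dx.
split=> X hX; last first.
  split; last by rewrite -mulmxA FD mulmxA.
  (* The image of [F] lies in the row space of [D^T g^-1]; pairing such a row with a vertical [V]
     through [g] leaves the factor [(V D)^T = 0]. *)
  move=> V; rewrite /vertical /pairing /f_matrix => VD.
  rewrite !mulmxA /cometric (mulmxKV (metric_unit g cx)) -mulmxA -trmx_mul VD.
  by rewrite trmx0 mulmx0 mxE.
by move: hX; rewrite /vertical /f_matrix !mulmxA => ->; rewrite !mul0mx.
Qed.

End PullbackFStructure.

(** * Holomorphic functions *)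

Section DifferentialRules.
Local Open Scope ring_scope.
Context {R : realType} {n : nat}.
Implicit Types (f : 'rV[R]_n -> R) (v X : 'rV[R]_n).

Lemma diffD_apply f1 f2 v X : differentiable f1 v -> differentiable f2 v ->
  'd (fun u => f1 u + f2 u) v X = 'd f1 v X + 'd f2 v X.
Proof.
move=> d1 d2; have d12 : differentiable (fun u => f1 u + f2 u) v by exact: differentiableD.
apply: etrans (diff_partial X d12) _.
apply: etrans (esym (f_equal2 +%R (diff_partial X d1) (diff_partial X d2))).
rewrite -big_split.
by apply: eq_bigr => i _; rewrite (partialD i d1 d2) mulrDr.
Qed.

Lemma diffN_apply f1 v X : differentiable f1 v ->
  'd (fun u => - f1 u) v X = - 'd f1 v X.
Proof.
move=> d1; have d2 : differentiable (fun u => - f1 u) v by exact: differentiableN.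
apply: etrans (diff_partial X d2) _.
apply: etrans (esym (f_equal -%R (diff_partial X d1))); rewrite -sumrN.
by apply: eq_bigr => i _; rewrite (partialN i d1) mulrN.
Qed.

Lemma diffM_apply f1 f2 v X : differentiable f1 v -> differentiable f2 v ->
  'd (fun u => f1 u * f2 u) v X = 'd f1 v X * f2 v + f1 v * 'd f2 v X.
Proof.
move=> d1 d2; have d12 : differentiable (fun u => f1 u * f2 u) v by exact: differentiableM.
apply: etrans (diff_partial X d12) _.
apply: etrans (esym (f_equal2 (fun a b => a * f2 v + f1 v * b)
  (diff_partial X d1) (diff_partial X d2))).
rewrite mulr_suml mulr_sumr -big_split.
by apply: eq_bigr => i _; rewrite (partialM i d1 d2) mulrDr mulrA [X in _ + X]mulrCA.
Qed.

End DifferentialRules.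

(** * Cauchy-Riemann equations and Hessians *)

Section CauchyRiemann.
Local Open Scope classical_set_scope.
Local Open Scope ring_scope.
Context {R : realType} {n : nat}.
Variable J : 'M[R]_n.

Lemma coord_hessian_sym (U : set 'rV[R]_n) f v : open U -> U v -> is_Ck 2 U f ->
  (coord_hessian f v)^T = coord_hessian f v.
Proof.
move=> oU Uv Cf; apply/matrixP => b a; rewrite [LHS]mxE [LHS]mxE [RHS]mxE.
by rewrite (partialC a b oU Uv Cf).
Qed.

(** The scalar [e] covers both Cauchy-Riemann systems: it is -1 when [f1] is the real part and 1
    when [f1] is the imaginary part. *)
Lemma coord_hessian_CR (U : set 'rV[R]_n) (f1 f2 : 'rV[R]_n -> R) (e : R) v :
  open U -> U v -> is_Ck 2 U f1 -> is_Ck 2 U f2 ->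
  (forall w i, U w -> \sum_k J i k * partial k f1 w = e * partial i f2 w) ->
  coord_hessian f1 v *m J^T = e *: coord_hessian f2 v.
Proof.
move=> oU Uv [d1 p1] [d2 p2] CR; apply/matrixP => b i.
have E : partial b (fun w => \sum_k J i k * partial k f1 w) v =
         partial b (fun w => e * partial i f2 w) v.
  apply: partial_near; apply: (@open_near_eq _ _ _ _ _ U) => // w Uw.
  exact: CR.
have dp1 k : differentiable (partial k f1) v by exact: (p1 k).1.
have dp2 k : differentiable (partial k f2) v by exact: (p2 k).1.
rewrite [RHS]mxE [coord_hessian f2 v b i]mxE.
move: E; rewrite (partialM b (differentiable_cst e v) (dp2 i)) partial_cst mul0r add0r.
move=> <-; rewrite (@partial_sum _ _ _ _ b (fun k w => J i k * partial k f1 w)).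
  rewrite mxE; apply: eq_bigr => k _; rewrite [coord_hessian _ _ _ _]mxE [_^T _ _]mxE.
  rewrite (partialM b (differentiable_cst (J i k) v) (dp1 k)) partial_cst mul0r add0r.
  exact: mulrC.
by move=> k; exact: differentiableM (differentiable_cst _ _) (dp1 k).
Qed.

(* The Hessians of the two components of a holomorphic function anticommute
   with J: H J^T is a multiple of the other Hessian, hence symmetric. *)
Lemma coord_hessian_anticomm (U : set 'rV[R]_n) (f1 f2 : 'rV[R]_n -> R) (e : R) v :
  J^T = - J -> open U -> U v -> is_Ck 2 U f1 -> is_Ck 2 U f2 ->
  (forall w i, U w -> \sum_k J i k * partial k f1 w = e * partial i f2 w) ->
  coord_hessian f1 v *m J = - (J *m coord_hessian f1 v).
Proof.
move=> JT oU Uv C1 C2 CR; have E := coord_hessian_CR oU Uv C1 C2 CR.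
have s1 := coord_hessian_sym oU Uv C1; have s2 := coord_hessian_sym oU Uv C2.
have : (coord_hessian f1 v *m J^T)^T = coord_hessian f1 v *m J^T.
  by rewrite E linearZ /= s2.
by rewrite trmx_mul trmxK s1 JT mulmxN => ->; rewrite opprK.
Qed.

End CauchyRiemann.

Section Holomorphic.
Local Open Scope classical_set_scope.
Local Open Scope ring_scope.
Context {R : realType} {n : nat} {N : smooth_manifold R (n + n)}.
Variable J : complex_structure N.
Implicit Types (d e : chart R N (n + n)) (y : N) (U : set N) (f : N -> R[i]).

Lemma smooth_on_differentiable U (u : N -> R) d y : open U -> smooth_on U u ->
  chart_at d y -> U y -> differentiable (u \o chart_inv d) (d y).
Proof.
move=> oU su [ad dy] Uy; apply: (is_Ck_differentiable (su d ad 1)).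
by exists y.
Qed.

Lemma complex_differentialM f1 f2 d y X :
  differentiable (fun u => complex.Re (f1 (chart_inv d u))) (d y) ->
  differentiable (fun u => complex.Im (f1 (chart_inv d u))) (d y) ->
  differentiable (fun u => complex.Re (f2 (chart_inv d u))) (d y) ->
  differentiable (fun u => complex.Im (f2 (chart_inv d u))) (d y) ->
  chart_dom d y ->
  complex_differential (fun z => f1 z * f2 z) d y X =
    complex_differential f1 d y X * f2 y + f1 y * complex_differential f2 d y X.
Proof.
move=> dr1 di1 dr2 di2 dy.
pose r1 u := complex.Re (f1 (chart_inv d u)); pose i1 u := complex.Im (f1 (chart_inv d u)).
pose r2 u := complex.Re (f2 (chart_inv d u)); pose i2 u := complex.Im (f2 (chart_inv d u)).
have ReE : (fun u => complex.Re (f1 (chart_inv d u) * f2 (chart_inv d u))) =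
    (fun u => r1 u * r2 u + - (i1 u * i2 u)).
  by apply/funext => u; rewrite /r1 /r2 /i1 /i2; case: (f1 _) => ? ?; case: (f2 _).
have ImE : (fun u => complex.Im (f1 (chart_inv d u) * f2 (chart_inv d u))) =
    (fun u => r1 u * i2 u + i1 u * r2 u).
  by apply/funext => u; rewrite /r1 /r2 /i1 /i2; case: (f1 _) => ? ?; case: (f2 _).
have dre : 'd (fun u => r1 u * r2 u + - (i1 u * i2 u)) (d y) X =
    'd r1 (d y) X * r2 (d y) + r1 (d y) * 'd r2 (d y) X -
    ('d i1 (d y) X * i2 (d y) + i1 (d y) * 'd i2 (d y) X).
  rewrite -(diffM_apply X dr1 dr2) -(diffM_apply X di1 di2).
  rewrite -(diffN_apply X (differentiableM di1 di2)).
  exact: diffD_apply (differentiableM dr1 dr2) (differentiableN (differentiableM di1 di2)).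
have dim : 'd (fun u => r1 u * i2 u + i1 u * r2 u) (d y) X =
    'd r1 (d y) X * i2 (d y) + r1 (d y) * 'd i2 (d y) X +
    ('d i1 (d y) X * r2 (d y) + i1 (d y) * 'd r2 (d y) X).
  rewrite -(diffM_apply X dr1 di2) -(diffM_apply X di1 dr2).
  exact: diffD_apply (differentiableM dr1 di2) (differentiableM di1 dr2).
have [E1 E2 E3 E4] : [/\ r1 (d y) = complex.Re (f1 y), i1 (d y) = complex.Im (f1 y),
    r2 (d y) = complex.Re (f2 y) & i2 (d y) = complex.Im (f2 y)].
  by rewrite /r1 /r2 /i1 /i2 (chart_mapK dy).
rewrite E1 E2 E3 E4 in dre dim.
have alg (p q s t : R) (w1 w2 : R[i]) :
    Complex (p * complex.Re w2 + complex.Re w1 * q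
               - (s * complex.Im w2 + complex.Im w1 * t))
            (p * complex.Im w2 + complex.Re w1 * t
               + (s * complex.Re w2 + complex.Im w1 * q)) =
    Complex p s * w2 + w1 * Complex q t.
  case: w1 => a b; case: w2 => a' b'.
  by apply/eqP; rewrite eq_complex /=; apply/andP; split; apply/eqP; ring.
rewrite /complex_differential ReE ImE.
apply: etrans (f_equal2 (@Complex R) dre dim) _.
exact: alg.
Qed.

(** Supplies the products of two complex coordinates as test functions. *)
Lemma holomorphic_onM U f1 f2 : open U -> holomorphic_on J U f1 ->
  holomorphic_on J U f2 -> holomorphic_on J U (fun y => f1 y * f2 y).
Proof.
move=> oU [sr1 si1 h1] [sr2 si2 h2].
have oV d : open (d @` (chart_dom d `&` U)) by exact: chart_image_open.
split.
- move=> d ad k; apply: (@is_Ck_eq _ _ _ _ (fun u =>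
      complex.Re (f1 (chart_inv d u)) * complex.Re (f2 (chart_inv d u)) +
      - (complex.Im (f1 (chart_inv d u)) * complex.Im (f2 (chart_inv d u))))).
  + exact: oV.
  + by move=> u _ /=; case: (f1 _) => ? ?; case: (f2 _).
  + apply: is_CkD => //; first by apply: is_CkM => //; [exact: sr1|exact: sr2].
    by apply: is_CkN => //; apply: is_CkM => //; [exact: si1|exact: si2].
- move=> d ad k; apply: (@is_Ck_eq _ _ _ _ (fun u =>
      complex.Re (f1 (chart_inv d u)) * complex.Im (f2 (chart_inv d u)) +
      complex.Im (f1 (chart_inv d u)) * complex.Re (f2 (chart_inv d u)))).
  + exact: oV.
  + by move=> u _ /=; case: (f1 _) => ? ?; case: (f2 _).
  + apply: is_CkD => //; first by apply: is_CkM => //; [exact: sr1|exact: si2].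
    by apply: is_CkM => //; [exact: si1|exact: sr2].
- move=> d y dy Uy X; have [_ ddy] := dy.
  have dr1 := smooth_on_differentiable oU sr1 dy Uy.
  have di1 := smooth_on_differentiable oU si1 dy Uy.
  have dr2 := smooth_on_differentiable oU sr2 dy Uy.
  have di2 := smooth_on_differentiable oU si2 dy Uy.
  rewrite !(complex_differentialM _ dr1 di1 dr2 di2 ddy) h1 // h2 //.
  by rewrite mulrDr -mulrA [f1 y * ('i%C * _)]mulrCA.
Qed.

Definition complex_coord d (a : 'I_n) y : R[i] :=
  Complex (d y 0 (lshift n a)) (d y 0 (rshift n a)).

Lemma coord_smooth_on d k : atlas d -> smooth_on (chart_dom d) (fun y => d y 0 k).
Proof. by move=> ad c ac; have [+ _] := atlas_compatible ac ad; exact. Qed.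

Lemma coord_differential d e y k X : chart_at d y -> chart_at e y ->
  'd (fun u => d (chart_inv e u) 0 k) (e y) X = (X *m transition_mx e d y) 0 k.
Proof.
move=> dy ey.
have dd : differentiable (d \o id \o chart_inv e) (e y).
  exact: (smooth_map_differentiable (smooth_map_id (M := N))).
by rewrite /transition_mx mul_rV_lin1; exact: (diff_row_coord k X dd).
Qed.

Lemma complex_coord_holomorphic d a : atlas d ->
  (forall z, chart_dom d z -> J d z = standard_J R n) ->
  holomorphic_on J (chart_dom d) (complex_coord d a).
Proof.
move=> ad Jstd; split; [exact: coord_smooth_on|exact: coord_smooth_on|].
move=> e y ey dy X; have dy' : chart_at d y by [].
rewrite /complex_differential /=.
have E k Y : 'd (fun u => d (chart_inv e u) 0 k) (e y) Y =
    (Y *m transition_mx e d y) 0 k by exact: coord_differential.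
(* Holomorphy is tested in an arbitrary chart [e]; the transition matrix exchanges the matrix of [J]
   there for the standard one. *)
rewrite !E -mulmxA (endo_transition J ey dy') (Jstd y dy) mulmxA.
have [El Er] := mul_standard_J (X *m transition_mx e d y).
rewrite El Er; apply/eqP; rewrite eq_complex /=.
by rewrite !mul0r !mul1r !add0r !eqxx.
Qed.

Lemma holomorphic_CR U f d : open U -> holomorphic_on J U f -> atlas d ->
  (forall z, chart_dom d z -> J d z = standard_J R n) ->
  let u1 q := complex.Re (f (chart_inv d q)) in
  let u2 q := complex.Im (f (chart_inv d q)) in
  forall q i, (d @` (chart_dom d `&` U)) q ->
    \sum_k standard_J R n i k * partial k u1 q = - 1 * partial i u2 q /\
    \sum_k standard_J R n i k * partial k u2 q = 1 * partial i u1 q.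
Proof.
move=> oU [sr si hol] ad Jstd u1 u2 _ i [z [dz Uz] <-].
have dz' : chart_at d z by [].
have dr : differentiable u1 (d z) := smooth_on_differentiable oU sr dz' Uz.
have di : differentiable u2 (d z) := smooth_on_differentiable oU si dz' Uz.
have cplx (a b a' b' : R) : Complex a b = 'i%C * Complex a' b' -> a = - b' /\ b = a'.
  by move/eqP; rewrite eq_complex /= !mul0r !mul1r !add0r => /andP[/eqP ? /eqP].
have [] := cplx _ _ _ _ (hol d z dz' Uz (delta_mx 0 i)).
rewrite (Jstd z dz) -rowE => E1 E2.
rewrite mulN1r mul1r (partialE i di) (partialE i dr).
have rowE u : \sum_k standard_J R n i k * partial k u (d z) =
    \sum_k row i (standard_J R n) 0 k * partial k u (d z).
  by apply: eq_bigr => k _; rewrite [row i _ 0 k]mxE.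
split; apply: etrans (rowE _) _.
  exact: etrans (esym (diff_partial (row i (standard_J R n)) dr)) E1.
exact: etrans (esym (diff_partial (row i (standard_J R n)) di)) E2.
Qed.

End Holomorphic.

(** * Pseudo-harmonic morphisms *)

Section Products.
Local Open Scope classical_set_scope.
Local Open Scope ring_scope.
Context {R : realType} {m : nat} {M : smooth_manifold R m}.
Variable g : riemannian_metric M.
Implicit Types (c : chart R M m) (x : M) (u v : M -> R).

Lemma C2_atM c u v x : C2_at c u x -> C2_at c v x -> C2_at c (fun y => u y * v y) x.
Proof.
move=> [U [oU Ux Cu]] [V [oV Vx Cv]]; exists (U `&` V); split => //; first exact: openI.
apply: is_CkM; first exact: openI.
  by apply: is_Ck_subset Cu => p [].
by apply: is_Ck_subset Cv => p [].
Qed.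

Lemma C2_atN c u x : C2_at c u x -> C2_at c (fun y => - u y) x.
Proof. by move=> [U [oU Ux Cu]]; exists U; split; [exact: oU|exact: Ux|exact: is_CkN oU Cu]. Qed.

Lemma laplacianD c u v x : chart_at c x -> C2_at c u x -> C2_at c v x ->
  laplacian g c (fun y => u y + v y) x = laplacian g c u x + laplacian g c v x.
Proof.
move=> cx Cu Cv; rewrite !(laplacianE _ _ cx) (hessianD g Cu Cv).
by rewrite linearD /= mulmxDr mxtraceD.
Qed.

Lemma laplacianN c u x : chart_at c x -> C2_at c u x ->
  laplacian g c (fun y => - u y) x = - laplacian g c u x.
Proof.
move=> cx Cu; rewrite !(laplacianE _ _ cx) (hessianN g Cu).
by rewrite linearN /= mulmxN mxtraceN.
Qed.

(** The factor 2 arises because the two gradient products are transposes of each other and have the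
    same trace against the symmetric cometric. *)
Lemma laplacianM c u v x : chart_at c x -> C2_at c u x -> C2_at c v x ->
  laplacian g c (fun y => u y * v y) x =
    v x * laplacian g c u x + u x * laplacian g c v x +
    2 * ((cgradient c u x)^T *m cometric g c x *m cgradient c v x) 0 0.
Proof.
move=> cx Cu Cv; rewrite !(laplacianE _ _ cx) (hessianM g cx Cu Cv).
have tD (A B : 'M[R]_m) : (A + B)^T = A^T + B^T by rewrite linearD.
have tZ a (A : 'M[R]_m) : (a *: A)^T = a *: A^T by rewrite linearZ.
rewrite !tD !tZ !mulmxDr !mxtraceD -!scalemxAr !mxtraceZ.
congr (_ + _); rewrite !trmx_mul !trmxK.
have trE (a b : 'cV[R]_m) : \tr (cometric g c x *m (b *m a^T)) =
    (a^T *m cometric g c x *m b) 0 0.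
  by rewrite mulmxA mxtrace_mulC mulmxA trace_mx11.
have symE (a b : 'cV[R]_m) : (b^T *m cometric g c x *m a) 0 0 =
    (a^T *m cometric g c x *m b) 0 0.
  transitivity ((b^T *m cometric g c x *m a)^T 0 0); first by rewrite [RHS]mxE.
  by rewrite !trmx_mul trmxK (cometric_sym g cx) mulmxA.
by rewrite !trE [X in _ + X]symE -mulr2n mulr_natl.
Qed.

End Products.

Section ComponentProducts.
Local Open Scope classical_set_scope.
Local Open Scope ring_scope.
Context {R : realType} {m n : nat}.
Context {M : smooth_manifold R m} {N : smooth_manifold R n}.
Variables (g : riemannian_metric M) (phi : M -> N).
Hypothesis sphi : smooth_map phi.
Implicit Types (c : chart R M m) (d : chart R N n) (x : M).

Lemma cgradient_component c d x k : chart_at c x -> chart_at d (phi x) ->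
  cgradient c (fun y => d (phi y) 0 k) x = col k (differential_mx phi c d x).
Proof.
move=> cx dx; apply/colP => i; rewrite mxE [RHS]mxE.
exact: (esym (differential_mx_entry i k sphi cx dx)).
Qed.

(** Once the components are harmonic, only the gradient term of the product rule survives, so
    Laplacians of products read off the entries of [gram]. *)
Lemma laplacian_component_product c d x k l : chart_at c x -> chart_at d (phi x) ->
  tension g phi c d x = 0 ->
  laplacian g c (fun y => d (phi y) 0 k * d (phi y) 0 l) x = 2 * gram g phi c d x k l.
Proof.
move=> cx dx t0.
have tE a : laplacian g c (fun y => d (phi y) 0 a) x = 0.
  by move/rowP/(_ a): t0; rewrite mxE [RHS]mxE.
rewrite (laplacianM g cx (component_C2_at sphi k cx dx) (component_C2_at sphi l cx dx)).
rewrite !tE !mulr0 !add0r !(cgradient_component _ cx dx) /gram; congr (_ * _).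
by rewrite tr_col -row_mul colE mulmxA -row_mul -colE [LHS]mxE [LHS]mxE.
Qed.

End ComponentProducts.

Section Main.
Local Open Scope classical_set_scope.
Local Open Scope ring_scope.
Context {R : realType} {m n : nat}.
Context {M : smooth_manifold R m} {N : smooth_manifold R (n + n)}.
Variables (g : riemannian_metric M) (J : complex_structure N).
Variables (h : riemannian_metric N) (hJ : hermitian_metric J h) (phi : M -> N).
Hypothesis sub : submersion phi.
Implicit Types (c : chart R M m) (d : chart R N (n + n)) (x : M).

Let sphi : smooth_map phi. Proof. by have [] := sub. Qed.

Definition complex_chart d := forall z, chart_dom d z -> J d z = standard_J R n.

(** Equal diagonal blocks and opposite off-diagonal ones are the shape of a complex matrix seen as a
    real one. *)
Lemma standard_comm (P : 'M[R]_(n + n)) :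
  (forall a b, P (lshift n a) (lshift n b) = P (rshift n a) (rshift n b)) ->
  (forall a b, P (lshift n a) (rshift n b) = - P (rshift n a) (lshift n b)) ->
  comm_mx P (standard_J R n).
Proof.
move=> P1 P2; rewrite -[P]submxK.
have -> : drsubmx P = ulsubmx P by apply/matrixP => a b; rewrite !mxE P1.
have -> : ursubmx P = - dlsubmx P by apply/matrixP => a b; rewrite !mxE P2.
rewrite /comm_mx /standard_J !mulmx_block.
by rewrite !(mul0mx, mulmx0, mul1mx, mulmx1, mulmxN, mulNmx, add0r, addr0, opprK).
Qed.

Lemma PHM_complex_chart c d x : pseudo_harmonic_morphism g J phi ->
  complex_chart d -> chart_at c x -> chart_at d (phi x) ->
  tension g phi c d x = 0 /\
  gram g phi c d x *m J d (phi x) + (J d (phi x))^T *m gram g phi c d x = 0.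
Proof.
move=> phm Jstd cx dx; have [ad ddx] := dx; have od := chart_dom_open d.
have holz a := complex_coord_holomorphic a ad Jstd.
have t0 : tension g phi c d x = 0.
  apply/rowP => k; rewrite [LHS]mxE [RHS]mxE.
  (* Each real coordinate is the real or the imaginary part of some [complex_coord]. *)
  case: (splitP k) => a ka.
    have -> : k = lshift n a by exact/val_inj.
    by have [[_ +] _] := phm _ _ od (holz a); apply.
  have -> : k = rshift n a by exact/val_inj.
  by have [_ [_ +]] := phm _ _ od (holz a); apply.
split=> //.
have C2p k l := C2_atM (component_C2_at sphi k cx dx) (component_C2_at sphi l cx dx).
have LP k l := laplacian_component_product sphi k l cx dx t0.
have two0 (p q : R) : 2 * p + 2 * q = 0 -> p = - q by lra.
have PJ : comm_mx (gram g phi c d x) (standard_J R n).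
  apply: standard_comm => a b.
    (* The real part of z_a z_b is x_a x_b - y_a y_b; its harmonicity equates the diagonal
       blocks. *)
    have [[_ +] _] := phm _ _ od (holomorphic_onM od (holz a) (holz b)).
    move=> /(_ c x cx ddx) E.
    rewrite -[RHS]opprK; apply: two0; rewrite mulrN -!LP -E.
    rewrite -(laplacianN g cx (C2p _ _)).
    exact/esym/(laplacianD g cx (C2p _ _) (C2_atN (C2p _ _))).
  (* The imaginary part is x_a y_b + y_a x_b; its harmonicity makes the off-diagonal blocks
     opposite. *)
  have [_ [_ +]] := phm _ _ od (holomorphic_onM od (holz a) (holz b)).
  move=> /(_ c x cx ddx) E.
  apply: two0; rewrite -!LP -E.
  exact/esym/(laplacianD g cx (C2p _ _) (C2p _ _)).
by rewrite (Jstd _ ddx) standard_J_tr mulNmx PJ subrr.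
Qed.

Lemma PHM_PHWC : pseudo_harmonic_morphism g J phi -> PHWC g J h phi.
Proof.
move=> phm c d x cx dx; apply/(PHWC_at g hJ cx dx).
have [d0 d0x Jstd] := complex_integrable J (phi x).
(* The test functions come from a complex chart [d0], while PHWC is asked in the given chart [d]. *)
apply: (gram_invariant sub cx d0x dx).
by have [_] := PHM_complex_chart phm Jstd cx d0x.
Qed.

Lemma divergence_tension (F : endo_field M) c d x : PHWC g J h phi ->
  induced_f_structure g J phi F -> complex_chart d ->
  chart_at c x -> chart_at d (phi x) ->
  divergence g F c x *m differential_mx phi c d x =
  tension g phi c d x *m standard_J R n.
Proof.
move=> phwc indF Jstd cx dx; have [ac _] := cx; have [ad _] := dx.
(* Stated at all points and in all charts, because the intertwining relation is needed near [x] and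
   not only at [x]. *)
have FE c' d' y : chart_at c' y -> chart_at d' (phi y) -> F c' y = f_matrix g J phi c' d' y.
  move=> cy dy; rewrite -(f_fieldE g J sub cy dy).
  exact: induced_f_structure_unique sub indF (f_field_induced g J sub) _ _ cy.
apply: (divergence_differential sphi cx dx).
  apply: filterS (near_overlap sphi cx dx) => q /chart_image_invP[cq dq _].
  have cq' : chart_at c (chart_inv c q) by [].
  have dq' : chart_at d (phi (chart_inv c q)) by [].
  by rewrite (FE _ _ _ cq' dq') (f_matrix_differential g J sub cq' dq') (Jstd _ dq).
rewrite (FE _ _ _ cx dx); apply: (f_matrix_skew sub cx dx).
exact: (PHWC_at g hJ cx dx).1 (phwc c d x cx dx).
Qed.

(** [f_matrix] begins with the factor [D], so a divergence killed by [D] is killed by [F]. *)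
Lemma PHM_cosymplectic : pseudo_harmonic_morphism g J phi ->
  cosymplectic g (f_field g J sub).
Proof.
move=> phm c x cx; have [d dx Jstd] := complex_integrable J (phi x).
have [t0 _] := PHM_complex_chart phm Jstd cx dx.
have := divergence_tension (PHM_PHWC phm) (f_field_induced g J sub) Jstd cx dx.
rewrite t0 mul0mx => D0; rewrite (f_fieldE g J sub cx dx) /f_matrix !mulmxA.
by rewrite D0 !mul0mx.
Qed.

(** Multiplied by [D], the cosymplectic equation becomes the tension times the square of
    [standard_J], that is, minus the tension. *)
Lemma cosymplectic_tension (F : endo_field M) c d x : PHWC g J h phi ->
  induced_f_structure g J phi F -> cosymplectic g F -> complex_chart d ->
  chart_at c x -> chart_at d (phi x) -> tension g phi c d x = 0.
Proof.
move=> phwc indF cosF Jstd cx dx; have [_ ddx] := dx.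
have E := divergence_tension phwc indF Jstd cx dx.
have FE : F c x = f_matrix g J phi c d x.
  rewrite -(f_fieldE g J sub cx dx).
  exact: induced_f_structure_unique sub indF (f_field_induced g J sub) _ _ cx.
have := cosF c x cx; rewrite FE => /(congr1 (mulmx^~ (differential_mx phi c d x))).
rewrite mul0mx -mulmxA (f_matrix_differential g J sub cx dx) (Jstd _ ddx) mulmxA E.
by rewrite -mulmxA standard_J_sqr mulmxN mulmx1 => /eqP; rewrite oppr_eq0 => /eqP.
Qed.

Lemma C2_on_comp (U : set N) (u : N -> R) : open U -> smooth_on U u ->
  C2_on (phi @^-1` U) (u \o phi).
Proof.
move=> oU su c ac; apply: is_Ck_local => _ [x [cx Ux] <-].
have [d ad dx] := atlas_cover (phi x); have [cphi Sphi] := sphi.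
pose W := c @` (chart_dom c `&` phi @^-1` (chart_dom d `&` U)).
have oW : open W.
  apply: chart_image_open; move/continuousP: cphi; apply.
  by apply: openI => //; exact: chart_dom_open.
exists W; first by exists x.
apply: (@is_Ck_eq _ _ _ _ ((u \o chart_inv d) \o (d \o phi \o chart_inv c))) => //.
  by move=> q /chart_image_invP[cq [dq Uq] _] /=; rewrite chart_mapK.
apply: (@is_Ck_comp _ _ _ _ _ (d @` (chart_dom d `&` U))) => //.
- by move=> _ [q /chart_image_invP[cq [dq Uq] _] <-]; exists (phi (chart_inv c q)).
- move=> j; apply: is_Ck_subset (Sphi c d ac ad j 2).
  by move=> _ [y [cy [dy _]] <-]; exists y.
- exact: su.
Qed.

(** [u1] is either part of a holomorphic function and [u2] the other one, with [e] as in
    [coord_hessian_CR], so that one argument serves both parts. *)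
Lemma laplacian_holomorphic_part (U : set N) (u1 u2 : N -> R) (e : R) c d x :
  PHWC g J h phi -> complex_chart d -> chart_at c x -> chart_at d (phi x) ->
  tension g phi c d x = 0 -> open U -> U (phi x) -> smooth_on U u1 -> smooth_on U u2 ->
  (forall q i, (d @` (chart_dom d `&` U)) q ->
    \sum_k standard_J R n i k * partial k (u1 \o chart_inv d) q =
    e * partial i (u2 \o chart_inv d) q) ->
  laplacian g c (u1 \o phi) x = 0.
Proof.
move=> phwc Jstd cx dx t0 oU Ux s1 s2 CR; have [ad ddx] := dx.
have oV : open (d @` (chart_dom d `&` U)) by exact: chart_image_open.
have Vx : (d @` (chart_dom d `&` U)) (d (phi x)) by exists (phi x).
have C1 := s1 d ad 2; have C2 := s2 d ad 2.
rewrite (laplacian_comp g sphi cx dx oV Vx C1) t0.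
rewrite [X in _ + X]big1 => [|a _]; last by rewrite mxE mulr0.
rewrite addr0 (coord_hessian_sym oV Vx C1).
have HJ := coord_hessian_anticomm (standard_J_tr (n := n)) oV Vx C1 C2 CR.
apply: (mxtrace_anticomm (standard_J_sqr (n := n))) HJ.
have := (PHWC_at g hJ cx dx).1 (phwc c d x cx dx).
rewrite (Jstd _ ddx) standard_J_tr mulNmx => /eqP.
by rewrite subr_eq0 => /eqP.
Qed.

Lemma PHM_of_tension : PHWC g J h phi ->
  (forall c d x, complex_chart d -> chart_at c x -> chart_at d (phi x) ->
    tension g phi c d x = 0) ->
  pseudo_harmonic_morphism g J phi.
Proof.
move=> phwc t0 U f oU hol; have [sr si _] := hol.
split; split; [exact: (C2_on_comp oU sr)| |exact: (C2_on_comp oU si)|].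
  move=> c x cx Ux; have [d dx Jstd] := complex_integrable J (phi x).
  apply: (laplacian_holomorphic_part (e := - 1) phwc Jstd cx dx _ oU Ux sr si).
    exact: t0.
  by move=> q i Vq; have [] := holomorphic_CR oU hol dx.1 Jstd i Vq.
move=> c x cx Ux; have [d dx Jstd] := complex_integrable J (phi x).
apply: (laplacian_holomorphic_part (e := 1) phwc Jstd cx dx _ oU Ux si sr).
  exact: t0.
by move=> q i Vq; have [] := holomorphic_CR oU hol dx.1 Jstd i Vq.
Qed.

End Main.

Theorem theorem3p1 (R : realType) (m n : nat)
    (M : smooth_manifold R m) (g : riemannian_metric M)
    (N : smooth_manifold R (n + n)) (J : complex_structure N)
    (h : riemannian_metric N) (hJ : hermitian_metric J h)
    (phi : M -> N) (phi_submersion : submersion phi) :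
  pseudo_harmonic_morphism g J phi <->
  PHWC g J h phi /\
  exists F : endo_field M, induced_f_structure g J phi F /\ cosymplectic g F.
Proof.
split=> [phm|[phwc [F [indF cosF]]]].
  split; first exact: PHM_PHWC phm.
  exists (f_field g J phi_submersion); split; first exact: f_field_induced.
  exact (PHM_cosymplectic hJ phi_submersion phm).
apply: (PHM_of_tension hJ phi_submersion phwc) => c d x Jstd cx dx.
exact: (cosymplectic_tension hJ phi_submersion phwc indF cosF Jstd cx dx).
Qed.
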